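(* Let $p\ge1$, $K\in\mathbb{N}\cup\{0\}$, $B>0$, and let $\Omega\subseteq\mathbb{R}$ be compact and contain an open interval around $0$; let $n$ be sufficiently large (depending on $K$). Consider ReluMPNN and SmoothMPNN of depth $K$ and arbitrary width on $G_{\le n}(\Omega)$: aggregation and readout each consist of a finite number of independent copies of $\{\!\!\{ x_1,\dots,x_s\}\!\!\}\mapsto\sum_{i=1}^s\rho(a\cdot x_i-b)$ with $a$ uniform on the unit sphere and $b$ uniform on $[-B,B]$, and the combine functions are linear with parameters uniform on unit spheres; here $\rho=\mathrm{ReLU}$ for ReluMPNN and $\rho$ is a smooth ($C^\infty$) function for SmoothMPNN. If ReluMPNN of depth $K$ is $\alpha$ lower-Hölder in expectation with respect to $TMD^{(K)}$, then $\alpha\ge1+\frac{K+1}{p}$. If SmoothMPNN of depth $K$ is $\alpha$ lower-Hölder in expectation with respect to $TMD^{(K)}$, then $\alpha\ge2^{K+1}$.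
   Context: $G_{\le n}(\Omega)$ is the set of graphs with at most $n$ nodes and node features in $\Omega$. A parametric function $f(G;w)$ with a probability measure on $w$ is $\alpha$ lower-Hölder in expectation w.r.t. a pseudo-metric $d$ if there is $c>0$ with $c^p\le\mathbb{E}_w\left[\left(\frac{\|f(G;w)-f(H;w)\|_p}{d(G,H)^\alpha}\right)^p\right]$ whenever $d(G,H)>0$. Fix $z\in\mathbb{R}\setminus\Omega$. Computation trees $T_v^{(k)}$: $T_v^{(0)}$ is a single node with feature $x_v$; $T_v^{(k)}$ is obtained from $T_v^{(k-1)}$ by attaching to each leaf (graph node $u$) children for the neighbors of $u$, with their features. The blank tree $\bar T_z$ is a single node with feature $z$; $\mathcal T_r$ is the multiset of subtrees rooted at the children of the root $r$. For tree multisets $A,B$ of size at most $n$, $W^{(\bar T_z)}_{TD,1}(A,B)=\min_{\tau\in S_n}\sum_j TD(A'_j,B'_{\tau(j)})$ after padding with $\bar T_z$ to $n$ elements. $TD(T_a,T_b)=|x_a-x_b|+W^{(\bar T_z)}_{TD,1}(\mathcal T_a,\mathcal T_b)$ if the maximal depth is positive, $|x_a-x_b|$ otherwise. $TMD^{(K)}(G,H)=W^{(\bar T_z)}_{TD,1}(\{\!\!\{ T_v^{(K)}\}\!\!\}_{v\in V_G},\{\!\!\{ T_u^{(K)}\}\!\!\}_{u\in V_H})$. An MPNN of depth $K$ computes $x_v^{(0)}=x_v$, $c_v^{(k)}=\phi^{(k)}(\{\!\!\{ x_u^{(k-1)}:u\in\mathcal N_v\}\!\!\})$, $x_v^{(k)}=\psi^{(k)}(x_v^{(k-1)},c_v^{(k)})$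 for $k=1,\dots,K$, and outputs $\upsilon(\{\!\!\{ x_v^{(K)}:v\in V\}\!\!\})$. *)

(* Defs.v *)
From HB Require Import structures.
From mathcomp Require Import all_boot all_order all_algebra all_fingroup.
From mathcomp Require Import all_classical all_reals all_analysis.

Set Implicit Arguments.
Unset Strict Implicit.
Unset Printing Implicit Defensive.

Import Order.TTheory GRing.Theory Num.Theory.
Import numFieldNormedType.Exports.

Local Open Scope classical_set_scope.
Local Open Scope ring_scope.

Section MPNN.
Variable R : realType.

Record graph := Graph {
  gsize : nat;
  gadj  : 'I_gsize -> 'I_gsize -> bool;
  gfeat : 'I_gsize -> R }.

Definition in_Gle (n : nat) (Omega : set R) (G : graph) : Prop :=
  [/\ (gsize G <= n)%N,
      (forall u v : 'I_(gsize G), gadj u v = gadj v u),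
      (forall v : 'I_(gsize G), gadj v v = false) &
      (forall v : 'I_(gsize G), Omega (gfeat v))].

Inductive ftree := FNode of R & seq ftree.

Definition froot (t : ftree) : R := let: FNode x _ := t in x.
Definition fchildren (t : ftree) : seq ftree := let: FNode _ cs := t in cs.

Fixpoint fdepth (t : ftree) : nat :=
  let: FNode _ cs := t in
  if cs is [::] then 0%N else (foldr maxn 0%N (map fdepth cs)).+1.

Definition blank (z : R) : ftree := FNode z [::].

Definition padT (n : nat) (z : R) (s : seq ftree) : seq ftree :=
  s ++ nseq (n - size s) (blank z).

Definition Wpad (n : nat) (z : R) (d : ftree -> ftree -> R)
    (A B : seq ftree) : R :=
  let A' := padT n z A in let B' := padT n z B in
  let cost (s : 'S_n) := \sum_(j < n) d (nth (blank z) A' j) (nth (blank z) B' (s j)) in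
  \big[Order.min/cost 1%g]_(s : 'S_n) cost s.

(* TD with explicit fuel k; the fuel used below is the maximal depth, which
   suffices since children have strictly smaller depth. *)
Fixpoint TDfuel (n : nat) (z : R) (k : nat) (a b : ftree) : R :=
  match k with
  | 0%N => `|froot a - froot b|
  | k'.+1 =>
      if maxn (fdepth a) (fdepth b) == 0%N then `|froot a - froot b|
      else `|froot a - froot b| + Wpad n z (TDfuel n z k') (fchildren a) (fchildren b)
  end.

Definition TD (n : nat) (z : R) (a b : ftree) : R :=
  TDfuel n z (maxn (fdepth a) (fdepth b)) a b.

Fixpoint comp_tree (G : graph) (k : nat) (v : 'I_(gsize G)) : ftree :=
  match k with
  | 0%N => FNode (gfeat v) [::]
  | k'.+1 => FNode (gfeat v) [seq comp_tree k' u | u <- enum 'I_(gsize G) & gadj v u]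
  end.

Definition TMD (n : nat) (z : R) (K : nat) (G H : graph) : R :=
  Wpad n z (TD n z) [seq comp_tree K v | v <- enum 'I_(gsize G)]
                    [seq comp_tree K u | u <- enum 'I_(gsize H)].

Definition dotv (a x : seq R) : R := \sum_(i < size a) a`_i * x`_i.
Definition subv (u v : seq R) : seq R := [seq t.1 - t.2 | t <- zip u v].
Definition pnorm (p : R) (v : seq R) : R :=
  (\sum_(i < size v) `|v`_i| `^ p) `^ p^-1.
Definition norm2 (v : seq R) : R := Num.sqrt (\sum_(i < size v) v`_i ^+ 2).
Definition normalize (v : seq R) : seq R := [seq x / norm2 v | x <- v].

Local Open Scope ereal_scope.

Fixpoint cubeInt (d : nat) (g : seq R -> \bar R) : \bar R :=
  match d with
  | 0%N => g [::]
  | d'.+1 => \int[lebesgue_measure]_(t in `[(-1)%R, 1%R]) cubeInt d' (fun s => g (t :: s))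
  end.

(* expectation w.r.t. the uniform distribution on the unit sphere S^{d-1} of
   R^d: the law of X/|X| for X uniform on the unit ball. *)
Definition Esphere (d : nat) (g : seq R -> \bar R) : \bar R :=
  cubeInt d (fun s => if (norm2 s < 1)%R then g (normalize s) else 0%E)
  * ((fine (cubeInt d (fun s => if (norm2 s < 1)%R then 1%E else 0%E)))^-1)%:E.

Definition Eunif (B : R) (g : R -> \bar R) : \bar R :=
  ((2 * B)^-1)%:E * \int[lebesgue_measure]_(b in `[(- B)%R, B]) g b.

Fixpoint Ecopies (X : Type) (m : nat) (draw : (X -> \bar R) -> \bar R)
    (g : seq X -> \bar R) : \bar R :=
  match m with
  | 0%N => g [::]
  | m'.+1 => draw (fun x => Ecopies m' draw (fun xs => g (x :: xs)))
  end.

Definition drawAB (d : nat) (B : R) (g : seq R * R -> \bar R) : \bar R :=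
  Esphere d (fun a => Eunif B (fun b => g (a, b))).

Local Close Scope ereal_scope.

(*  widths: w k = number of aggregation copies at layer k (1<=k<=K),   *)
(*          dm k = output dimension of the combine at layer k,         *)
(*          wout = number of readout copies; input dimension is 1.     *)

Definition layer_params := (seq (seq R * R) * seq (seq R))%type.
Definition mpnn_params := (seq layer_params * seq (seq R * R))%type.

Definition hdim (dm : nat -> nat) (k : nat) : nat := if k == 0%N then 1%N else dm k.

Fixpoint Elayers (B : R) (w dm : nat -> nat) (rem i : nat)
    (g : seq layer_params -> \bar R) : \bar R :=
  match rem with
  | 0%N => g [::]
  | rem'.+1 =>
      Ecopies (w i) (drawAB (hdim dm i.-1) B) (fun P =>
      Ecopies (dm i) (Esphere (hdim dm i.-1 + w i)) (fun Q =>
      Elayers B w dm rem' i.+1 (fun L => g ((P, Q) :: L))))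
  end.

Definition Enet (B : R) (K : nat) (w dm : nat -> nat) (wout : nat)
    (g : mpnn_params -> \bar R) : \bar R :=
  Elayers B w dm K 1 (fun L =>
    Ecopies wout (drawAB (hdim dm K) B) (fun P => g (L, P))).

Definition mpnn_layer (rho : R -> R) (G : graph) (lp : layer_params)
    (h : 'I_(gsize G) -> seq R) (v : 'I_(gsize G)) : seq R :=
  let c := [seq \sum_(u < gsize G | gadj v u) rho (dotv ab.1 (h u) - ab.2) | ab <- lp.1] in
  [seq dotv q (h v ++ c) | q <- lp.2].

Definition mpnn (rho : R -> R) (G : graph) (prm : mpnn_params) : seq R :=
  let h0 := fun v : 'I_(gsize G) => [:: gfeat v] in
  let hK := foldl (fun h lp => mpnn_layer rho lp h) h0 prm.1 in
  [seq \sum_(v < gsize G) rho (dotv ab.1 (hK v) - ab.2) | ab <- prm.2].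

Definition relu (t : R) : R := Num.max t 0.

Definition smooth (f : R -> R) : Prop :=
  forall (k : nat) (x : R), derivable (iter k (fun g : R -> R => derive1 g) f) x 1.

Definition lower_holder_exp (X : Type) (E : (X -> \bar R) -> \bar R)
    (f : graph -> X -> seq R) (dom : graph -> Prop)
    (dist : graph -> graph -> R) (p alpha : R) : Prop :=
  exists c : R, (0 < c)%R /\
    forall G H, dom G -> dom H -> (0 < dist G H)%R ->
      ((c `^ p)%:E <=
         E (fun prm => (((pnorm p (subv (f G prm) (f H prm))) / (dist G H `^ alpha)) `^ p)%:E))%E.

End MPNN.

(* Main.v *)
(** The hard pair is built recursively. On level 0 take the multisets
    G_0 = {eps, -eps} and H_0 = {0, 0}; writing N(X) for a node of feature 0 with
    children X, put G_(j+1) = {N(G_j + G_j), N(H_j + H_j)} and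
    H_(j+1) = {N(G_j + H_j), N(G_j + H_j)}. At each level the features of the
    two nodes of G_j have the feature of the nodes of H_j as midpoint, so the
    difference of the aggregations over G_j and H_j is a second difference of
    rho. For smooth rho a second difference squares the size of the gap, which
    starts at eps and ends at eps^(2^(K+1)). For ReLU the gap stays of size eps,
    but it vanishes unless some bias hits an interval of length O(eps), at each
    of the K+1 independent aggregations; hence the p-th moment is
    O(eps^(p+K+1)). The tree distance of the pair is at least eps, because
    all node features are 0, eps, -eps or z, so distances are 0 or at least
    eps, and a Weisfeiler-Leman type invariant shows that the distance is not 0. The trees
    share their lower levels, arranged so that every node has four parents. *)

Require Import Defs.
From HB Require Import structures.
From mathcomp Require Import all_boot all_order all_algebra all_fingroup.
From mathcomp Require Import all_classical all_reals all_analysis.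
From mathcomp Require Import measurable_realfun ring lra zify.
Import Order.TTheory GRing.Theory Num.Theory.
Import numFieldNormedType.Exports.
Set Implicit Arguments.
Unset Strict Implicit.
Unset Printing Implicit Defensive.
Local Open Scope classical_set_scope.
Local Open Scope ring_scope.

(** * Upper bounds for the expectations *)

Section UpperBounds.
Import HBNNSimple.
Variable R : realType.
Local Open Scope ereal_scope.

(* The integrands of the iterated expectations are not known to be measurable;
   for upper bounds the definition of the integral as a supremum suffices. *)
Lemma integral_le_nomeas d (T : measurableType d) (mu : {measure set T -> \bar R})
    (D : set T) (f g : T -> \bar R) :
  (forall x, D x -> 0 <= f x) -> (forall x, D x -> f x <= g x) ->
  \int[mu]_(x in D) f x <= \int[mu]_(x in D) g x.
Proof.
move=> f0 fg; have g0 x : D x -> 0 <= g x by move=> Dx; exact: le_trans (f0 _ Dx) (fg _ Dx).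
rewrite !ge0_integralE//; apply: ereal_sup_le => _ [h hf <-].
exists h => //= x; apply: le_trans (hf x) _.
by rewrite /patch; case: ifPn => // /set_mem; exact: fg.
Qed.

(** Dividing a simple function below [M * f] by [M] gives one below [f]; the case [M = 0] is
    separate, since both sides then vanish. *)
Lemma integral_scale_nomeas d (T : measurableType d)
    (mu : {measure set T -> \bar R}) (D : set T) (f : T -> \bar R) (M : R) :
  (0 <= M)%R -> (forall x, D x -> 0 <= f x) ->
  \int[mu]_(x in D) (M%:E * f x) <= M%:E * \int[mu]_(x in D) f x.
Proof.
rewrite le_eqVlt => /predU1P[<-|M0] f0.
  by rewrite mul0e integral0_eq// => x _; rewrite mul0e.
rewrite !ge0_integralE//; last by move=> x Dx; rewrite mule_ge0 ?f0// lee_fin ltW.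
apply/ge_ereal_sup => _ [h /= hf <-].
have Mi0 : (0 <= M^-1)%R by rewrite invr_ge0 ltW.
rewrite -lee_pdivrMl// -sintegralrM; apply: ereal_sup_ubound => /=.
exists (scale_nnsfun h Mi0) => //= x.
rewrite EFinM -lee_pdivlMl ?invr_gt0// invrK.
apply: le_trans (hf x) _; rewrite /patch; case: ifPn => //.
by rewrite mule0.
Qed.

Lemma cubeInt_ge0 d (g : seq R -> \bar R) :
  (forall s, 0 <= g s) -> 0 <= cubeInt d g.
Proof.
elim: d g => [|d IH] g g0 /=; first exact: g0.
by apply: integral_ge0 => x _; apply: IH.
Qed.

Lemma cubeInt_le d (f g : seq R -> \bar R) :
  (forall s, 0 <= f s) -> (forall s, size s = d -> f s <= g s) ->
  cubeInt d f <= cubeInt d g.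
Proof.
elim: d f g => [|d IH] f g f0 fg /=; first exact: fg.
apply: integral_le_nomeas => x _; first exact: cubeInt_ge0.
by apply: IH => // s sd; apply: fg; rewrite /= sd.
Qed.

Lemma cubeInt_scale d (f : seq R -> \bar R) (M : R) :
  (0 <= M)%R -> (forall s, 0 <= f s) ->
  cubeInt d (fun s => M%:E * f s) <= M%:E * cubeInt d f.
Proof.
move=> M0; elim: d f => [|d IH] f f0 //=.
apply: (@le_trans _ _ (\int[lebesgue_measure]_(t in `[(-1)%R, 1%R])
  (M%:E * cubeInt d (fun s => f (t :: s))))).
  apply: integral_le_nomeas => x _; last exact: IH.
  by apply: cubeInt_ge0 => s; rewrite mule_ge0.
by apply: integral_scale_nomeas => // x _; exact: cubeInt_ge0.
Qed.

(** A coordinatewise weakening of being a unit vector. It holds for every output of [normalize],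
    including that of the zero vector, where division by 0 yields 0. *)
Definition unit_box (d : nat) (a : seq R) : Prop :=
  size a = d /\ forall i, (`|a`_i| <= 1)%R.

Lemma normalize_unit_box (s : seq R) : unit_box (size s) (normalize s).
Proof.
split; first by rewrite size_map.
move=> i; have [si|si] := leqP (size s) i.
  by rewrite nth_default ?size_map// normr0 ler01.
rewrite /normalize (nth_map 0%R)//.
have n0 : (0 <= norm2 s)%R by exact: sqrtr_ge0.
have le : (`|s`_i| <= norm2 s)%R.
  rewrite -sqrtr_sqr ler_sqrt ?sumr_ge0// => [|j _]; last exact: sqr_ge0.
  rewrite (bigD1 (Ordinal si))//= lerDl sumr_ge0// => j _; exact: sqr_ge0.
rewrite normrM normfV (ger0_norm n0).
move: n0; rewrite le_eqVlt => /predU1P[<-|n0]; first by rewrite invr0 mulr0 ler01.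
by rewrite ler_pdivrMr// mul1r.
Qed.

Lemma Esphere_ge0 d (g : seq R -> \bar R) :
  (forall s, 0 <= g s) -> 0 <= Esphere d g.
Proof.
move=> g0; rewrite /Esphere mule_ge0//.
  by apply: cubeInt_ge0 => s; case: ifP.
rewrite lee_fin invr_ge0 fine_ge0//; by apply: cubeInt_ge0 => s; case: ifP.
Qed.

(** The integral over the ball is at most [M] times the volume [Z]. No value of [Z] enters: if [Z]
    is infinite or 0, then [(fine Z)^-1] is 0 and so is the product. *)
Lemma Esphere_le d (g : seq R -> \bar R) (M : R) :
  (0 <= M)%R -> (forall s, 0 <= g s) ->
  (forall a, unit_box d a -> g a <= M%:E) -> Esphere d g <= M%:E.
Proof.
move=> M0 g0 gM; rewrite /Esphere.
set J := cubeInt d _; set Z := cubeInt d _.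
have Z0 : 0 <= Z by apply: cubeInt_ge0 => s; case: ifP.
have JZ : J <= M%:E * Z.
  apply: le_trans (cubeInt_scale _ M0 _); last by move=> s; case: ifP.
  apply: cubeInt_le => s; first by case: ifP.
  move=> sd; case: ifP => _; last by rewrite mule0.
  by rewrite mule1; apply: gM; rewrite -sd; exact: normalize_unit_box.
case: (boolP (Z \is a fin_num)) => [Zf|Zf]; last first.
  suff -> : fine Z = 0%R by rewrite invr0 mule0 lee_fin.
  by case: (Z) Zf Z0 => //=.
apply: (@le_trans _ _ (M%:E * Z * ((fine Z)^-1)%:E)).
  by apply: lee_wpmul2r => //; rewrite lee_fin invr_ge0 fine_ge0.
rewrite -(fineK Zf) /= -!EFinM lee_fin -mulrA.
have [->|nz] := eqVneq (fine Z) 0%R; first by rewrite mul0r mulr0.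
by rewrite divff// mulr1.
Qed.

Lemma Eunif_ge0 (B : R) (g : R -> \bar R) :
  (0 < B)%R -> (forall b, 0 <= g b) -> 0 <= Eunif B g.
Proof.
move=> B0 g0; rewrite /Eunif mule_ge0//; last exact: integral_ge0.
by rewrite lee_fin invr_ge0 mulr_ge0// ltW.
Qed.

(** Under the uniform law on [[-B, B]] an interval of radius [r] has probability at most
    [2 r / (2 B)], wherever its centre [m] lies. *)
Lemma Eunif_le (B : R) (g : R -> \bar R) (M' M m r : R) :
  (0 < B)%R -> (0 <= M')%R -> (0 <= M)%R -> (0 <= r)%R -> (forall b, 0 <= g b) ->
  (forall b, (`|b| <= B)%R ->
     g b <= (if (`|b - m| <= r)%R then M' + M else M')%R%:E) ->
  Eunif B g <= (M' + M * (r / B))%:E.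
Proof.
move=> B0 M'0 M0 r0 g0 gM; rewrite /Eunif.
rewrite muleC -lee_pdivlMr ?invr_gt0 ?mulr_gt0// invrK -EFinM.
set I := `[(m - r)%R, (m + r)%R]%classic.
apply: (@le_trans _ _ (\int[lebesgue_measure]_(b in `[(- B)%R, B])
   (M'%:E + M%:E * (\1_I b)%:E))).
  apply: integral_le_nomeas => // b; rewrite /= in_itv/= => bB.
  apply: le_trans (gM b _) _; first by rewrite ler_norml.
  rewrite indicE -EFinM -EFinD lee_fin.
  case: ifP; last by move=> _; rewrite lerDl mulr_ge0.
  rewrite ler_norml => /andP[h1 h2]; rewrite mem_set ?mulr1//.
  by rewrite /I /= in_itv/=; apply/andP; split; lra.
have mI : measurable I by exact: measurable_itv.
have M1 x : 0 <= M%:E * (\1_I x)%:E by rewrite -EFinM lee_fin mulr_ge0.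
rewrite ge0_integralD//=; last first.
  by apply/measurable_EFinP; apply: measurable_funM => //; exact: measurable_indic.
rewrite integral_cst//= ge0_integralZl_EFin//; last first.
  by apply/measurable_EFinP; exact: measurable_indic.
rewrite integral_indic//.
apply: (@le_trans _ _ (M'%:E * (2 * B)%:E + M%:E * (2 * r)%:E)).
  apply: leeD; apply: lee_wpmul2l; rewrite ?lee_fin//.
    by rewrite lebesgue_measure_itv/= lte_fin; case: ifP => _; rewrite ?lee_fin; lra.
  apply: (@le_trans _ _ (lebesgue_measure I)).
    by apply: le_measure; rewrite ?inE//; exact: measurableI.
  by rewrite lebesgue_measure_itv/= lte_fin; case: ifP => _; rewrite -?EFinD ?lee_fin; lra.
rewrite -!EFinM -EFinD lee_fin (_ : ((M' + _) * _ = M' * (2 * B) + M * (2 * r))%R)//.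
by field; rewrite gt_eqF.
Qed.

Definition ball_box (d : nat) (B : R) (ab : seq R * R) : Prop :=
  unit_box d ab.1 /\ (`|ab.2| <= B)%R.

Lemma drawAB_ge0 d (B : R) (g : seq R * R -> \bar R) :
  (0 < B)%R -> (forall ab, 0 <= g ab) -> 0 <= drawAB d B g.
Proof. by move=> B0 g0; apply: Esphere_ge0 => a; apply: Eunif_ge0. Qed.

(** The bias is integrated inside the integral over directions, so the centre of the exceptional
    interval may depend on the direction. *)
Lemma drawAB_le d (B : R) (g : seq R * R -> \bar R) (m : seq R -> R) (M' M r : R) :
  (0 < B)%R -> (0 <= M')%R -> (0 <= M)%R -> (0 <= r)%R -> (forall ab, 0 <= g ab) ->
  (forall ab, ball_box d B ab ->
     g ab <= (if (`|ab.2 - m ab.1| <= r)%R then M' + M else M')%R%:E) ->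
  drawAB d B g <= (M' + M * (r / B))%:E.
Proof.
move=> B0 M'0 M0 r0 g0 gM; apply: Esphere_le.
- by rewrite addr_ge0// mulr_ge0// divr_ge0// ltW.
- by move=> a; exact: Eunif_ge0.
move=> a ha; apply: (Eunif_le (m := m a)) => // b hb.
exact: (gM (a, b)).
Qed.

Lemma Ecopies_ge0 (X : Type) k (draw : (X -> \bar R) -> \bar R) (g : seq X -> \bar R) :
  (forall f, (forall x, 0 <= f x) -> 0 <= draw f) ->
  (forall xs, 0 <= g xs) -> 0 <= Ecopies k draw g.
Proof.
move=> dr; elim: k g => [|k IH] g g0 /=; first exact: g0.
by apply: dr => x; apply: IH.
Qed.

Fixpoint Forall_seq (X : Type) (P : X -> Prop) (s : seq X) : Prop :=
  if s is x :: s' then P x /\ Forall_seq P s' else True.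

Lemma Ecopies_le (X : Type) k (draw : (X -> \bar R) -> \bar R)
    (P : X -> Prop) (g : seq X -> \bar R) (M : R) :
  (forall f, (forall x, 0 <= f x) -> 0 <= draw f) ->
  (forall f, (forall x, 0 <= f x) -> (forall x, P x -> f x <= M%:E) -> draw f <= M%:E) ->
  (forall xs, 0 <= g xs) ->
  (forall xs, size xs = k -> Forall_seq P xs -> g xs <= M%:E) ->
  Ecopies k draw g <= M%:E.
Proof.
move=> dr0 dr; elim: k g => [|k IH] g g0 gM /=; first exact: gM.
apply: dr => x; first exact: Ecopies_ge0.
by move=> Px; apply: IH => // xs sk Pxs; apply: gM => //=; rewrite sk.
Qed.

(** Union bound: each of the [k] independent biases falls into its exceptional interval with
    probability at most [r / B]. *)
Lemma Ecopies_drawAB_le k d (B : R) (g : seq (seq R * R) -> \bar R)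
    (m : seq R -> R) (M r : R) :
  (0 < B)%R -> (0 <= M)%R -> (0 <= r)%R -> (forall P, 0 <= g P) ->
  (forall P, size P = k -> Forall_seq (ball_box d B) P ->
     g P <= (if has (fun ab : seq R * R => `|ab.2 - m ab.1| <= r)%R P then M else 0%R)%:E) ->
  Ecopies k (drawAB d B) g <= (M * (k%:R * (r / B)))%:E.
Proof.
move=> B0 M0 r0; set q := (r / B)%R.
have q0 : (0 <= q)%R by rewrite divr_ge0// ltW.
have dr0 f : (forall x, 0 <= f x) -> 0 <= drawAB d B f by exact: drawAB_ge0.
elim: k g => [|k IH] g g0 gM /=.
  by apply: le_trans (gM [::] _ _) _ => //=; rewrite mul0r mulr0.
apply: (@le_trans _ _ (M * (k%:R * q) + M * q)%:E); last first.
  by rewrite lee_fin -natr1 mulrDl mul1r mulrDr.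
have Mkq : (0 <= M * (k%:R * q))%R by rewrite mulr_ge0 // mulr_ge0 // ler0n.
(* The first copy has the bound of the induction hypothesis as base value, plus [M] when its own
   bias is exceptional. *)
apply: (drawAB_le (m := m)) => //; first by move=> ab; exact: Ecopies_ge0.
move=> ab hab; case: ifPn => bad; last first.
  apply: IH => // P sP hP; apply: le_trans (gM _ _ _) _ => //=; first by rewrite sP.
  by rewrite (negbTE bad).
apply: (@le_trans _ _ M%:E); last by rewrite lee_fin lerDr.
apply: (Ecopies_le (P := ball_box d B)) => //.
  (* A constant bound is the case of [drawAB_le] with exceptional part 0. *)
  move=> f f0 fM; have -> : M = (M + 0 * (0 / B))%R by rewrite mul0r addr0.
  apply: (drawAB_le (m := fun=> 0%R)) => // ab' h'.
  by apply: le_trans (fM _ h') _; rewrite addr0 if_same.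
move=> P sP hP; apply: le_trans (gM _ _ _) _ => //=; first by rewrite sP.
by case: ifP.
Qed.

End UpperBounds.

(** * The hard graphs and message passing on them *)

Section LayeredGraphs.
Variables (R : realType) (K : nat).

Definition tag3 : finType := (bool * bool * bool)%type.

(* A node on level l > 0 carries a kind k (true for the first graph, false for
   the second), an index d in its pair and a copy index c; it has four children
   (k', d', c') on level l - 1, one for each (d', c'), with k' given below.  On
   the top level K all nodes have the kind k0 of the graph itself. *)
Definition child_kind (k d c : bool) : bool := if k then ~~ d else c (+) d.

Definition kind_at (k0 : bool) (l : nat) (k : bool) : bool := if l == K then k0 else k.

Definition parent_of (k0 : bool) (l : nat) (x y : tag3) : bool :=
  y.1.1 == child_kind (kind_at k0 l x.1.1) x.1.2 y.2.

Definition leaf_feat (eps : R) (k0 : bool) (l : nat) (x : tag3) : R :=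
  if (l == 0%N) && kind_at k0 l x.1.1 then (if x.1.2 then - eps else eps) else 0.

Definition vtx : finType := ('I_K.+1 * tag3)%type.

Definition vadj (k0 : bool) (v w : vtx) : bool :=
  ((v.1 == w.1.+1 :> nat) && parent_of k0 v.1 v.2 w.2)
  || ((w.1 == v.1.+1 :> nat) && parent_of k0 w.1 w.2 v.2).

Definition hard_graph (eps : R) (k0 : bool) : graph R :=
  Graph (fun u v : 'I_#|vtx| => vadj k0 (enum_val u) (enum_val v))
        (fun v => leaf_feat eps k0 (enum_val v).1 (enum_val v).2).

Lemma card_vtx : #|vtx| = (8 * K.+1)%N.
Proof. by rewrite card_prod card_ord !card_prod card_bool mulnC. Qed.

Lemma vadj_sym k0 v w : vadj k0 v w = vadj k0 w v.
Proof. by rewrite /vadj orbC. Qed.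

Lemma vadj_irr k0 v : vadj k0 v v = false.
Proof. by rewrite /vadj ltn_eqF. Qed.

Lemma leaf_feat_le eps k0 l x : 0 <= eps -> `|leaf_feat eps k0 l x| <= eps.
Proof.
move=> e0; rewrite /leaf_feat; case: ifP => _; last by rewrite normr0.
by case: ifP => _; rewrite ?normrN ger0_norm.
Qed.

Lemma sum_tag3 (F : tag3 -> R) :
  \sum_x F x = \sum_k \sum_d \sum_c F (k, d, c).
Proof.
rewrite pair_bigA /= pair_bigA /=; apply: eq_bigr => -[[k d] c] _ //.
Qed.

Lemma sum_children k0 l x (F : tag3 -> R) :
  \sum_(y | parent_of k0 l x y) F y =
  \sum_c \sum_d F (child_kind (kind_at k0 l x.1.1) x.1.2 c, d, c).
Proof.
rewrite big_mkcond sum_tag3 !big_bool /parent_of /=.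
case: (kind_at _ _ _); case: (x.1.2); rewrite /child_kind /= ?add0r ?addr0;
  first [by rewrite addrACA | by rewrite addrC].
Qed.

(** For each kind of parent exactly one index [d] fits the child, with both copy indices, which
    gives [2 + 2]; the exclusive or in [child_kind] provides this balance. On the top level the kind
    tag is a mere label, but still counts twice. *)
Lemma sum_parents k0 l x (a : R) :
  \sum_(y | parent_of k0 l y x) a = a *+ 4.
Proof.
rewrite big_mkcond sum_tag3 !big_bool /parent_of /kind_at /=.
case: x => -[k d] c /=; case: (l == K); case: k0; case: k; case: c;
  by rewrite /= ?add0r ?addr0 -!mulr2n -mulrnA.
Qed.

Definition nbr_sum (k0 : bool) (l : nat) (x : tag3) (F : nat -> tag3 -> R) : R :=
  (if l is l'.+1 then \sum_(y | parent_of k0 l x y) F l' y else 0)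
  + (if (l < K)%N then \sum_(y | parent_of k0 l.+1 y x) F l.+1 y else 0).

Lemma sum_ord_eq n m (A : nat -> R) :
  \sum_(i < n) (if m == i :> nat then A i else 0) = if (m < n)%N then A m else 0.
Proof.
rewrite -big_mkcond /=; case: ltnP => mn.
  by rewrite (big_pred1 (Ordinal mn)).
by rewrite big_pred0 // => i; rewrite gtn_eqF // (leq_trans (ltn_ord i)).
Qed.

Lemma sum_vadj k0 (v : vtx) (F : nat -> tag3 -> R) :
  \sum_(w | vadj k0 v w) F w.1 w.2 = nbr_sum k0 v.1 v.2 F.
Proof.
rewrite big_mkcond /= -(pair_bigA _ (fun (i : 'I_K.+1) (y : tag3) =>
   if vadj k0 v (i, y) then F i y else 0)) /= /nbr_sum.
case: v => l x /=.
rewrite (eq_bigr (fun i : 'I_K.+1 =>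
  (if l == i.+1 :> nat then \sum_(y | parent_of k0 l x y) F i y else 0)
  + (if l.+1 == i :> nat then \sum_(y | parent_of k0 i y x) F i y else 0))); last first.
  move=> i _; rewrite /vadj /=.
  have [li|li] := eqVneq (nat_of_ord l) i.+1.
    have -> : (nat_of_ord i == l.+1) = false by lia.
    have -> : (l.+1 == i)%N = false by lia.
    by rewrite addr0 /= [RHS]big_mkcond; apply: eq_bigr => y _; rewrite orbF.
  rewrite add0r /= eq_sym; case: ifP => h; first by rewrite [RHS]big_mkcond.
  by rewrite big1.
rewrite big_split /= (sum_ord_eq _ _ (fun i => \sum_(y | parent_of k0 i y x) F i y)).
congr (_ + _); case: l => -[|l] hl /=; first by rewrite big1.
rewrite (sum_ord_eq _ l (fun i => \sum_(y | parent_of k0 l.+1 x y) F i y)) /=.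
by rewrite (ltn_trans (ltnSn l) hl).
Qed.

Section MessagePassing.
Variable X : Type.

(** Message passing with states in an arbitrary type, as a list of message functions and an update.
    It serves twice: with feature vectors for the MPNN, and with pairs of reals for the tree
    invariant. *)
Definition mp_layer := (seq (X -> R) * (X -> seq R -> X))%type.

Definition mp_step (k0 : bool) (lay : mp_layer) (h : nat -> tag3 -> X) : nat -> tag3 -> X :=
  fun l x => lay.2 (h l x) [seq nbr_sum k0 l x (fun l' y => m (h l' y)) | m <- lay.1].

(** The reduced state after [i] rounds: one value for each level above [i], and on level [i] one
    value for each kind and index. *)
Definition mp_core := ((nat -> X) * (bool -> bool -> X))%type.

Definition core_init (x0 : X) (f : bool -> bool -> X) : mp_core := (fun=> x0, f).

(* The factors 4 count the neighbors on each adjacent level. *)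
Definition core_step (i : nat) (lay : mp_layer) (s : mp_core) : mp_core :=
  (fun l => lay.2 (s.1 l)
     [seq (if l is l'.+1 then m (s.1 l') *+ 4 else 0)
          + (if (l < K)%N then m (s.1 l.+1) *+ 4 else 0) | m <- lay.1],
   fun k d => lay.2 (s.1 i.+1)
     [seq \sum_c \sum_d' m (s.2 (child_kind k d c) d')
          + (if (i.+1 < K)%N then m (s.1 i.+2) *+ 4 else 0) | m <- lay.1]).

(* After i rounds, nodes above level i have seen no leaf, nodes on level i see
   their own subtree only, and below the top level the two graphs agree. *)
Definition core_rel (i : nat) (s : mp_core) (h : bool -> nat -> tag3 -> X) : Prop :=
  [/\ forall k0 l x, (i < l <= K)%N -> h k0 l x = s.1 l,
      forall l x, (l < K)%N -> h true l x = h false l x &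
      forall k0 x, h k0 i x = s.2 (kind_at k0 i x.1.1) x.1.2].

(** Nodes on level [i.+1] combine their children on level [i] with parents that are all still alike,
    so the active level moves up by one. *)
Lemma core_rel_step i lay s h : (i < K)%N -> core_rel i s h ->
  core_rel i.+1 (core_step i lay s) (fun k0 => mp_step k0 lay (h k0)).
Proof.
move=> iK [h1 h2 h3]; split.
- move=> k0 l x /andP[il lK]; rewrite /mp_step /= h1 ?(ltnW il) //.
  congr (lay.2 _ _); apply: eq_map => m; rewrite /nbr_sum; congr (_ + _).
    case: l il lK => // l il lK; rewrite sum_children !big_bool /= !h1 //; try lia.
    by rewrite -!mulr2n -mulrnA.
  case: ifP => // lK'; rewrite -(sum_parents k0 l.+1 x); apply: eq_bigr => y _.
  by rewrite h1 //; lia.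
- move=> l x lK; rewrite /mp_step h2 //.
  congr (lay.2 _ _); apply: eq_map => m; rewrite /nbr_sum; congr (_ + _).
    case: l lK => // l lK; apply: eq_big => [y|y _]; last by rewrite h2 // ltnW.
    by rewrite /parent_of /kind_at ltn_eqF.
  rewrite lK; have [lK'|lK'] := ltnP l.+1 K.
    apply: eq_big => [y|y _]; last by rewrite h2.
    by rewrite /parent_of /kind_at ltn_eqF.
  (* The parents lie on the top level, where adjacency depends on [k0]; as [i < K], they still share
     one state, and there are four of them in either graph. *)
  have E k0 : \sum_(y | parent_of k0 l.+1 y x) m (h k0 l.+1 y) = m (s.1 l.+1) *+ 4.
    by rewrite -(sum_parents k0 l.+1 x); apply: eq_bigr => y _; rewrite h1 //; lia.
  by rewrite !E.
- move=> k0 x; rewrite /mp_step h1 ?iK ?ltnSn //=.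
  congr (lay.2 _ _); apply: eq_map => m; rewrite /nbr_sum; congr (_ + _).
    rewrite sum_children; apply: eq_bigr => c _; apply: eq_bigr => d _.
    by rewrite h3 /kind_at ltn_eqF.
  case: ifP => // iK'; rewrite -(sum_parents k0 i.+2 x); apply: eq_bigr => y _.
  by rewrite h1 //; lia.
Qed.

(** All levels below the top cancel. On the top level the state depends on [d] only, and the kind
    tag and copy index give the multiplicity 4. *)
Lemma core_rel_readout s h (out : X -> R) : core_rel K s h ->
  \sum_(v : vtx) out (h true v.1 v.2) - \sum_(v : vtx) out (h false v.1 v.2)
  = (\sum_d out (s.2 true d) - \sum_d out (s.2 false d)) *+ 4.
Proof.
move=> [_ h2 h3].
rewrite -!(pair_bigA _ (fun (i : 'I_K.+1) (y : tag3) => out (h _ i y))) /=.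
rewrite !big_ord_recr /= opprD addrACA.
rewrite (eq_bigr (fun i : 'I_K => \sum_y out (h false i y))); last first.
  by move=> i _; apply: eq_bigr => y _; rewrite h2.
rewrite subrr add0r !sum_tag3 !big_bool /= !h3 /kind_at eqxx /=; ring.
Qed.

Fixpoint core_run (i : nat) (L : seq mp_layer) (s : mp_core) : mp_core :=
  if L is lay :: L' then core_run i.+1 L' (core_step i lay s) else s.

Fixpoint mp_run (k0 : bool) (L : seq mp_layer) (h : nat -> tag3 -> X) : nat -> tag3 -> X :=
  if L is lay :: L' then mp_run k0 L' (mp_step k0 lay h) else h.

Lemma core_rel_run L i s h : (i + size L <= K)%N -> core_rel i s h ->
  core_rel (i + size L) (core_run i L s) (fun k0 => mp_run k0 L (h k0)).
Proof.
elim: L i s h => [|lay L IH] i s h /=; first by rewrite addn0.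
rewrite addnS => iK hs; rewrite -addSn; apply: IH => //.
by apply: core_rel_step => //; apply: leq_trans iK; rewrite ltnS leq_addr.
Qed.

End MessagePassing.

Definition init_core (X : Type) (f : R -> X) (eps : R) : mp_core X :=
  core_init (f 0) (fun k d => f (if k then (if d then - eps else eps) else 0)).

Lemma core_rel_init X (f : R -> X) eps :
  core_rel 0 (init_core f eps) (fun k0 l x => f (leaf_feat eps k0 l x)).
Proof.
split=> //.
- by move=> k0 [].
- by move=> l x lK; rewrite /leaf_feat /kind_at (ltn_eqF lK).
Qed.

Lemma sum_hard_graph eps k0 (F : vtx -> R) (P : pred vtx) :
  \sum_(v < gsize (hard_graph eps k0) | P (enum_val v)) F (enum_val v) = \sum_(v | P v) F v.
Proof.
by rewrite [RHS](reindex (@enum_val vtx predT)) //=; apply: onW_bij; exact: enum_val_bij.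
Qed.

Definition mpnn_mp_layer (rho : R -> R) (q : layer_params R) : mp_layer (seq R) :=
  ([seq (fun h : seq R => rho (dotv ab.1 h - ab.2)) | ab <- q.1],
   fun h c => [seq dotv r (h ++ c) | r <- q.2]).

Lemma mpnn_layers_hard rho eps k0 (L : seq (layer_params R))
    (hG : 'I_(gsize (hard_graph eps k0)) -> seq R) (h : nat -> tag3 -> seq R) :
  (forall v, hG v = h (enum_val v).1 (enum_val v).2) ->
  forall v : 'I_(gsize (hard_graph eps k0)),
  foldl (fun g q => mpnn_layer rho q g) hG L v =
  mp_run k0 [seq mpnn_mp_layer rho q | q <- L] h (enum_val v).1 (enum_val v).2.
Proof.
elim: L hG h => [|q L IH] hG h hE //= v.
apply: IH => {}v; rewrite /mpnn_layer /mp_step /=.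
apply: eq_map => r; congr (dotv r (_ ++ _)); first exact: hE.
rewrite -map_comp; apply: eq_map => ab /=; rewrite -sum_vadj.
rewrite -(sum_hard_graph eps k0 (fun w => rho (dotv ab.1 (h w.1 w.2) - ab.2))) /=.
by apply: eq_bigr => u _; rewrite hE.
Qed.

Lemma mpnn_hard rho eps k0 L P :
  mpnn rho (hard_graph eps k0) (L, P) =
  [seq \sum_(v : vtx) rho (dotv ab.1 (mp_run k0 [seq mpnn_mp_layer rho q | q <- L]
     (fun l x => [:: leaf_feat eps k0 l x]) v.1 v.2) - ab.2) | ab <- P].
Proof.
rewrite /mpnn /=; apply: eq_map => ab.
rewrite -(sum_hard_graph eps k0 (fun w => rho (dotv ab.1 (mp_run _ _ _ w.1 w.2) - ab.2)) xpredT).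
apply: eq_bigr => v _.
by rewrite (mpnn_layers_hard _ _ (h := fun l x => [:: leaf_feat eps k0 l x])).
Qed.

Definition mpnn_core rho eps (L : seq (layer_params R)) : mp_core (seq R) :=
  core_run 0 [seq mpnn_mp_layer rho q | q <- L] (init_core (fun x => [:: x]) eps).

(** This quantity governs both the readout on the top level and, in [core_step], the gap passed to
    the next level. *)
Definition readout_gap (rho : R -> R) (ab : seq R * R) (s : mp_core (seq R)) : R :=
  \sum_d rho (dotv ab.1 (s.2 true d) - ab.2) - \sum_d rho (dotv ab.1 (s.2 false d) - ab.2).

Lemma mpnn_hard_diff rho eps L P : size L = K ->
  subv (mpnn rho (hard_graph eps true) (L, P)) (mpnn rho (hard_graph eps false) (L, P)) =
  [seq readout_gap rho ab (mpnn_core rho eps L) *+ 4 | ab <- P].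
Proof.
move=> sL; have := core_rel_run _ (core_rel_init (fun x => [:: x]) eps).
move/(_ [seq mpnn_mp_layer rho q | q <- L]); rewrite add0n size_map sL => /(_ (leqnn K)) hr.
rewrite !mpnn_hard /subv zip_map -map_comp; apply: eq_map => ab /=.
exact: (core_rel_readout (fun h => rho (dotv ab.1 h - ab.2)) hr).
Qed.

End LayeredGraphs.

(** * Tree mover's distance of the hard pair *)

Section TreeDistance.
Variables (R : realType) (n : nat) (z : R).

(** The bound on the number of children makes padding yield exactly [n] entries; [P] is a set of
    admissible features. *)
Fixpoint tree_ok (P : pred R) (t : ftree R) : bool :=
  let: FNode x cs := t in [&& P x, (size cs <= n)%N & all (tree_ok P) cs].

(* An isomorphism invariant of trees that ignores the padding tree; it is used
   to certify that the two hard graphs are at nonzero distance. *)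
Fixpoint tree_inv (t : ftree R) : R :=
  let: FNode x cs := t in
  if x == z then 0 else x ^+ 2 + (foldr +%R 0 (map tree_inv cs)) ^+ 2.

Lemma tree_invE x cs : x != z ->
  tree_inv (FNode x cs) = x ^+ 2 + (\sum_(c <- cs) tree_inv c) ^+ 2.
Proof. by move=> /= /negPf ->; rewrite foldrE big_map. Qed.

Lemma tree_inv_blank : tree_inv (blank z) = 0.
Proof. by rewrite /= eqxx. Qed.

Lemma nth_padT_ind (Q : ftree R -> bool) cs j :
  Q (blank z) -> all Q cs -> Q (nth (blank z) (padT n z cs) j).
Proof.
move=> Qb /(all_nthP (blank z)) Qc; rewrite /padT nth_cat; case: ifP => [/Qc //|_].
by rewrite nth_nseq if_same.
Qed.

Lemma sum_tree_inv_padT cs : (size cs <= n)%N ->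
  \sum_(c <- cs) tree_inv c = \sum_(j < n) tree_inv (nth (blank z) (padT n z cs) j).
Proof.
move=> sn; have sp : size (padT n z cs) = n by rewrite size_cat size_nseq subnKC.
rewrite -(big_mkord xpredT (fun j => tree_inv (nth (blank z) (padT n z cs) j))).
rewrite -[X in index_iota 0 X]sp -(big_nth (blank z) xpredT tree_inv) big_cat /=.
suff -> : \sum_(t <- nseq (n - size cs) (blank z)) tree_inv t = 0 by rewrite addr0.
elim: (n - size cs)%N => [|m IH] /=; first by rewrite big_nil.
by rewrite big_cons tree_inv_blank IH addr0.
Qed.

Lemma Wpad_attained (d : ftree R -> ftree R -> R) A B :
  exists s : 'S_n, Wpad n z d A B =
    \sum_(j < n) d (nth (blank z) (padT n z A) j) (nth (blank z) (padT n z B) (s j)).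
Proof.
pose cost (s : 'S_n) := \sum_(j < n)
  d (nth (blank z) (padT n z A) j) (nth (blank z) (padT n z B) (s j)).
apply: (big_ind (fun x => exists s : 'S_n, x = cost s)).
- by exists 1%g.
- by move=> x y [s ->] [t ->]; rewrite minEle; case: ifP => _; [exists s|exists t].
- by move=> s _; exists s.
Qed.

Lemma TDfuel_ge0 k a b : 0 <= TDfuel n z k a b.
Proof.
elim: k a b => [|k IH] a b /=; first exact: normr_ge0.
case: ifP => _; first exact: normr_ge0.
have [s ->] := Wpad_attained (TDfuel n z k) (fchildren a) (fchildren b).
by rewrite addr_ge0 // sumr_ge0.
Qed.

Lemma tree_ok_nth (P : pred R) t j : P z -> tree_ok P t ->
  tree_ok P (nth (blank z) (padT n z (fchildren t)) j).
Proof.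
by case: t => x cs Pz /= /and3P[_ _ h]; apply: nth_padT_ind; rewrite //= Pz.
Qed.

Lemma tree_ok_root (P : pred R) t : tree_ok P t -> P (Defs.froot t).
Proof. by case: t => x cs /= /and3P[]. Qed.

Lemma sum_gap (eps : R) m (F : 'I_m -> R) : 0 <= eps ->
  (forall j, F j = 0 \/ eps <= F j) ->
  \sum_(j < m) F j = 0 \/ eps <= \sum_(j < m) F j.
Proof.
move=> e0 h; apply: (big_ind (fun x => x = 0 \/ eps <= x)) => //; first by left.
by move=> x y [->|hx] [->|hy]; rewrite ?addr0 ?add0r; [left|right|right|right; lra].
Qed.

(** With distinct features at least [eps] apart, every cost is a sum of terms that are 0 or at least
    [eps]. *)
Lemma TDfuel_gap (P : pred R) eps k a b : 0 <= eps -> P z ->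
  (forall x y, P x -> P y -> x = y \/ eps <= `|x - y|) ->
  tree_ok P a -> tree_ok P b ->
  TDfuel n z k a b = 0 \/ eps <= TDfuel n z k a b.
Proof.
move=> e0 Pz gap; elim: k a b => [|k IH] a b ha hb /=.
  by have [->|h] := gap _ _ (tree_ok_root ha) (tree_ok_root hb); rewrite ?subrr ?normr0; [left|right].
have [s sE] := Wpad_attained (TDfuel n z k) (fchildren a) (fchildren b).
have [->|h] := gap _ _ (tree_ok_root ha) (tree_ok_root hb); last first.
  right; case: ifP => // _; apply: le_trans h _.
  by rewrite lerDl sE sumr_ge0 // => j _; exact: TDfuel_ge0.
rewrite subrr normr0 add0r; case: ifP => _; first by left.
by rewrite sE; apply: sum_gap => // j; apply: IH; exact: tree_ok_nth.
Qed.

(** The root costs at most [D] and each of the [n] padded children at most the previous bound, so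
    each level costs a factor [n.+1]. *)
Lemma TDfuel_le (P : pred R) D k a b : 0 <= D -> P z ->
  (forall x y, P x -> P y -> `|x - y| <= D) ->
  tree_ok P a -> tree_ok P b -> TDfuel n z k a b <= D * n.+1%:R ^+ k.
Proof.
move=> D0 Pz hD; elim: k a b => [|k IH] a b ha hb /=.
  by rewrite expr0 mulr1; apply: hD; exact: tree_ok_root.
have h0 : `|Defs.froot a - Defs.froot b| <= D by apply: hD; exact: tree_ok_root.
have pk : (1 : R) <= n.+1%:R ^+ k by rewrite exprn_ege1 // ler1n.
have [s sE] := Wpad_attained (TDfuel n z k) (fchildren a) (fchildren b).
have hW : Wpad n z (TDfuel n z k) (fchildren a) (fchildren b) <= n%:R * (D * n.+1%:R ^+ k).
  rewrite sE; apply: (@le_trans _ _ (\sum_(j < n) D * n.+1%:R ^+ k)).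
    by apply: ler_sum => j _; apply: IH; exact: tree_ok_nth.
  by rewrite sumr_const card_ord -[X in X <= _]mulr_natl.
have -> : D * n.+1%:R ^+ k.+1 = n%:R * (D * n.+1%:R ^+ k) + D * n.+1%:R ^+ k.
  by rewrite exprSr -natr1; ring.
have DD : D <= D * n.+1%:R ^+ k by rewrite ler_peMr.
have n0 : 0 <= n%:R * (D * n.+1%:R ^+ k) by rewrite mulr_ge0 // mulr_ge0 // exprn_ge0.
case: ifP => _; first by apply: le_trans h0 _; lra.
by lra.
Qed.

(** Along an optimal permutation all costs are 0, so the padded lists match with equal invariants;
    the blanks add 0 to both sums. *)
Lemma Wpad_eq0_inv d A B : (forall a b, 0 <= d a b) ->
  (size A <= n)%N -> (size B <= n)%N ->
  (forall i j, let a := nth (blank z) (padT n z A) i in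
     let b := nth (blank z) (padT n z B) j in d a b = 0 -> tree_inv a = tree_inv b) ->
  Wpad n z d A B = 0 ->
  \sum_(c <- A) tree_inv c = \sum_(c <- B) tree_inv c.
Proof.
move=> d0 sA sB h; have [s ->] := Wpad_attained d A B.
move=> /psumr_eq0P s0.
rewrite !sum_tree_inv_padT // [RHS](reindex_inj (@perm_inj _ s)) /=.
by apply: eq_bigr => j _; apply: h; apply: s0.
Qed.

Lemma fdepth_nth t k j : (fdepth t <= k.+1)%N ->
  (fdepth (nth (blank z) (padT n z (fchildren t)) j) <= k)%N.
Proof.
case: t => x cs h; apply: (nth_padT_ind (Q := fun t => fdepth t <= k)%N) => //.
case: cs h => // c cs h; have {h} : (foldr maxn 0 (map (@fdepth R) (c :: cs)) <= k)%N by [].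
rewrite [fchildren _]/=; elim: (c :: cs) => //= t s IH.
by rewrite geq_max => /andP[-> /IH].
Qed.

Lemma fdepth0_children (t : ftree R) : fdepth t = 0%N -> fchildren t = [::].
Proof. by case: t => x []. Qed.

Lemma tree_ok_size (P : pred R) t : tree_ok P t -> (size (fchildren t) <= n)%N.
Proof. by case: t => x cs /= /and3P[]. Qed.

Lemma tree_inv_root x y cs ds : x = y ->
  \sum_(c <- cs) tree_inv c = \sum_(c <- ds) tree_inv c ->
  tree_inv (FNode x cs) = tree_inv (FNode y ds).
Proof.
move=> <- h; have [->|xz] := eqVneq x z; first by rewrite /= eqxx.
by rewrite !tree_invE // h.
Qed.

(** With fuel at least both depths the recursion is not cut off, so a zero cost forces equal roots
    and, by induction, equal sums of invariants over the children. *)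
Lemma TDfuel_eq0_inv (P : pred R) k a b : P z -> tree_ok P a -> tree_ok P b ->
  (fdepth a <= k)%N -> (fdepth b <= k)%N ->
  TDfuel n z k a b = 0 -> tree_inv a = tree_inv b.
Proof.
move=> Pz; have D0 : forall a b, fdepth a = 0%N -> fdepth b = 0%N ->
    `|Defs.froot a - Defs.froot b| = 0 -> tree_inv a = tree_inv b.
  move=> {}a {}b /fdepth0_children + /fdepth0_children.
  case: a => x cs; case: b => y ds /= -> -> /eqP.
  by rewrite normr_eq0 subr_eq0 => /eqP ->.
elim: k a b => [|k IH] a b ha hb.
  by rewrite !leqn0 => /eqP a0 /eqP b0 /=; exact: D0.
move=> da db /=; case: ifPn => [|_].
  by rewrite -leqn0 geq_max !leqn0 => /andP[/eqP a0 /eqP b0]; exact: D0.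
have W0 : 0 <= Wpad n z (TDfuel n z k) (fchildren a) (fchildren b).
  have [s ->] := Wpad_attained (TDfuel n z k) (fchildren a) (fchildren b).
  by rewrite sumr_ge0 // => j _; exact: TDfuel_ge0.
move/eqP; rewrite paddr_eq0 ?normr_ge0 // normr_eq0 subr_eq0 => /andP[/eqP rab /eqP w0].
have ch : \sum_(c <- fchildren a) tree_inv c = \sum_(c <- fchildren b) tree_inv c.
  apply: (Wpad_eq0_inv (@TDfuel_ge0 k)) w0; [exact: tree_ok_size ha|exact: tree_ok_size hb|].
  by move=> i j /=; apply: IH; by [exact: tree_ok_nth|exact: fdepth_nth].
by case: a b rab ch {ha hb da db W0 w0} => [x cs] [y ds] /= xy ch; exact: tree_inv_root.
Qed.

Lemma tree_ok_comp (P : pred R) (G : graph R) k v :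
  (forall v, P (gfeat (g := G) v)) -> (gsize G <= n)%N -> tree_ok P (comp_tree (G := G) k v).
Proof.
move=> Pf sG; elim: k v => [|k IH] v /=; rewrite Pf //=.
rewrite size_map size_filter (leq_trans (count_size _ _)) ?size_enum_ord //=.
by rewrite all_map; apply/allP => u _ /=; exact: IH.
Qed.

Lemma fdepth_comp (G : graph R) k v : (fdepth (comp_tree (G := G) k v) <= k)%N.
Proof.
elim: k v => [|k IH] v //=.
case E : [seq _ | _ <- _ & _] => [//|c cs]; rewrite -E ltnS.
by elim: [seq _ <- _ | _] => //= u s IHs; rewrite geq_max IH.
Qed.

Lemma comp_trees_nth (P : pred R) (G : graph R) k j :
  P z -> (forall v, P (gfeat (g := G) v)) -> (gsize G <= n)%N ->
  let t := nth (blank z) (padT n z [seq comp_tree k v | v <- enum 'I_(gsize G)]) j in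
  tree_ok P t /\ (fdepth t <= k)%N.
Proof.
move=> Pz Pf sG t; apply/andP.
apply: (nth_padT_ind (Q := fun t => tree_ok P t && (fdepth t <= k)%N)).
  by rewrite /= Pz.
by rewrite all_map; apply/allP => v _ /=; rewrite tree_ok_comp // fdepth_comp.
Qed.

End TreeDistance.

(** * Lower and upper bounds on the distance of the two hard graphs *)

Section HardPairDistance.
Variables (R : realType) (K n : nat) (z : R).

(** One level of [tree_inv] as a message passing round: the first component keeps the feature, the
    second carries the invariant of the computation tree. *)
Definition inv_layer : mp_layer R (R * R) :=
  ([:: snd], fun s c => (s.1, s.1 ^+ 2 + (c`_0) ^+ 2)).

(** [mp_run] peels off the first layer, whereas a computation tree unfolds at its root, that is, at
    the last layer; for equal layers the two orders agree. *)
Lemma mp_run_step (X : Type) k0 k (lay : mp_layer R X) h :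
  mp_run K k0 (nseq k lay) (mp_step K k0 lay h) = mp_step K k0 lay (mp_run K k0 (nseq k lay) h).
Proof. by elim: k h => //= k IH h; rewrite IH. Qed.

Lemma tree_inv_hard eps k0 k v : (forall l x, leaf_feat K eps k0 l x != z) ->
  tree_inv z (comp_tree (G := hard_graph K eps k0) k v) =
  (mp_run K k0 (nseq k inv_layer)
    (fun l x => (leaf_feat K eps k0 l x, leaf_feat K eps k0 l x ^+ 2))
    (enum_val v).1 (enum_val v).2).2.
Proof.
move=> fz; set h := fun l x => _.
have h1 j l x : (mp_run K k0 (nseq j inv_layer) h l x).1 = leaf_feat K eps k0 l x.
  by elim: j => //= j IH; rewrite mp_run_step.
elim: k v => [|k IH] v.
  by rewrite tree_invE //= big_nil expr0n /= addr0.
rewrite [comp_tree _ _]/= tree_invE // big_map big_filter big_enum_cond /=.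
rewrite mp_run_step /mp_step /= h1 -sum_vadj.
rewrite -(sum_hard_graph eps k0 (fun w => (mp_run K k0 (nseq k inv_layer) h w.1 w.2).2)) /=.
by congr (_ + _ ^+ 2); apply: eq_bigr => u _; exact: IH.
Qed.

(** With [g], [h] the sums over the two pairs and [A] the contribution of the parents, [(2g + A)^2 +
    (2h + A)^2 - 2 (g + h + A)^2 = 2 (g - h)^2], so a difference persists to the next level. *)
Lemma inv_core_run k i (s : mp_core (R * R)) :
  (forall l, (s.1 l).1 = 0) ->
  \sum_d (s.2 true d).2 != \sum_d (s.2 false d).2 ->
  \sum_d ((core_run K i (nseq k inv_layer) s).2 true d).2 !=
  \sum_d ((core_run K i (nseq k inv_layer) s).2 false d).2.
Proof.
elim: k i s => [//|k IH] i s s1 sd; apply: IH => //=.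
rewrite !big_bool /= !s1 expr0n /= !add0r.
set A := (if _ then _ else _).
move: sd; rewrite !big_bool /=; set g := _ + _; set h := _ + _ => gh.
rewrite -subr_eq0 (_ : _ - _ = (g - h) ^+ 2 *+ 2); last by ring.
by rewrite mulrn_eq0 /= expf_eq0 /= subr_eq0.
Qed.

Lemma sum_inv_hard_neq eps : 0 < eps -> (forall k0 l x, leaf_feat K eps k0 l x != z) ->
  \sum_(t <- [seq comp_tree K v | v <- enum 'I_(gsize (hard_graph K eps true))]) tree_inv z t !=
  \sum_(t <- [seq comp_tree K v | v <- enum 'I_(gsize (hard_graph K eps false))]) tree_inv z t.
Proof.
move=> e0 fz; rewrite big_map [X in _ != X]big_map !big_enum /=.
under eq_bigr do rewrite tree_inv_hard //.
under [X in _ != X]eq_bigr do rewrite tree_inv_hard //.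
have E k0 := sum_hard_graph eps k0 (fun w => (mp_run K k0 (nseq K inv_layer)
    (fun l x => (leaf_feat K eps k0 l x, leaf_feat K eps k0 l x ^+ 2)) w.1 w.2).2) xpredT.
rewrite !E -subr_eq0.
have := core_rel_run (L := nseq K inv_layer) _ (core_rel_init K (fun x : R => (x, x ^+ 2)) eps).
rewrite add0n size_nseq => /(_ (leqnn K)).
move/(core_rel_readout snd) => /= ->.
(* The induction starts on level 0 with the sums [2 eps^2] and 0. *)
rewrite mulrn_eq0 /= subr_eq0; apply: inv_core_run => //=.
rewrite !big_bool /= sqrrN expr0n /= addr0; apply: lt0r_neq0.
by rewrite addr_gt0 // exprn_gt0.
Qed.

(** The distance is 0 or at least [eps], and the value 0 would make the sums of the invariants
    agree. *)
Lemma TMD_hard_ge eps : 0 < eps -> 2 * eps <= `|z| -> (8 * K.+1 <= n)%N ->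
  eps <= TMD n z K (hard_graph K eps true) (hard_graph K eps false).
Proof.
move=> e0 ez Kn.
(* These are the only features in the padded trees; [2 * eps <= |z|] keeps [z] at distance at least
   [eps] from the others. *)
pose P : pred R := [pred x | [|| x == z, x == 0, x == eps | x == - eps]].
have Pz : P z by rewrite /P /= eqxx.
have Pf k0 v : P (gfeat (g := hard_graph K eps k0) v).
  rewrite /P /= /leaf_feat; case: ifP => _; last by rewrite eqxx orbT.
  by case: ifP => _; rewrite eqxx !orbT.
have sG k0 : (gsize (hard_graph K eps k0) <= n)%N by rewrite /= card_vtx.
have zb x : `|x| <= eps -> eps <= `|z - x|.
  by move=> xe; apply: le_trans (lerB_dist z x); lra.
have z0 x : x \in [:: 0; eps; - eps] -> `|x| <= eps.
  by rewrite !inE => /or3P[] /eqP ->; rewrite ?normr0 ?normrN ?gtr0_norm // ltW.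
have gap x y : P x -> P y -> x = y \/ eps <= `|x - y|.
  have P' w : P w -> w = z \/ w \in [:: 0; eps; - eps].
    by rewrite /P /= !inE => /orP[/eqP|]; [left|right].
  move=> /P'[->|hx] /P'[->|hy]; first by left.
  - by right; apply: zb; exact: z0.
  - by right; rewrite distrC; apply: zb; exact: z0.
  move: hx hy; rewrite !inE => /or3P[] /eqP -> /or3P[] /eqP ->; by [left|
   right; rewrite ler_normr; apply/orP; (left + right); lra].
have all_ok k0 j := comp_trees_nth K j Pz (Pf k0) (sG k0).
have [s sE] := Wpad_attained n z (TD n z)
   [seq comp_tree K v | v <- enum 'I_(gsize (hard_graph K eps true))]
   [seq comp_tree K v | v <- enum 'I_(gsize (hard_graph K eps false))].
have [t0|//] : TMD n z K (hard_graph K eps true) (hard_graph K eps false) = 0 \/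
   eps <= TMD n z K (hard_graph K eps true) (hard_graph K eps false).
  rewrite /TMD sE; apply: sum_gap; first exact: ltW.
  move=> j; apply: (TDfuel_gap (P := P)) => //; first exact: ltW.
    by have [] := all_ok true j.
  by have [] := all_ok false (s j).
have fz k0 l x : leaf_feat K eps k0 l x != z.
  apply/eqP => h; have := leaf_feat_le K k0 l x (ltW e0); rewrite h; lra.
have /eqP[] := sum_inv_hard_neq e0 fz.
apply: (Wpad_eq0_inv _ _ _ _ t0).
- by move=> a b; exact: TDfuel_ge0.
- by rewrite size_map size_enum_ord.
- by rewrite size_map size_enum_ord.
move=> i j /=; have [a1 a2] := all_ok true i; have [b1 b2] := all_ok false j.
by apply: (TDfuel_eq0_inv Pz) => //; rewrite ?leq_maxl ?leq_maxr.
Qed.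

(** A bound uniform in [eps] serves negative exponents, for which [d^(- alpha)] grows with the
    distance [d]. *)
Lemma TMD_hard_le eps : 0 <= eps <= 1 -> (8 * K.+1 <= n)%N ->
  TMD n z K (hard_graph K eps true) (hard_graph K eps false)
  <= n%:R * (2 * (1 + `|z|) * n.+1%:R ^+ K).
Proof.
move=> /andP[e0 e1] Kn; set D := 2 * _.
have z0 := normr_ge0 z.
have D0 : 0 <= D by rewrite /D; lra.
pose P : pred R := [pred x | `|x| <= 1 + `|z|].
have Pz : P z by rewrite /P /= lerDr.
have Pf k0 v : P (gfeat (g := hard_graph K eps k0) v).
  by rewrite /P /=; have := leaf_feat_le K k0 (enum_val v).1 (enum_val v).2 e0; lra.
have sG k0 : (gsize (hard_graph K eps k0) <= n)%N by rewrite /= card_vtx.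
have hD x y : P x -> P y -> `|x - y| <= D.
  by rewrite /P /= /D => hx hy; have := ler_normB x y; lra.
have all_ok k0 j := comp_trees_nth K j Pz (Pf k0) (sG k0).
have [s sE] := Wpad_attained n z (TD n z)
   [seq comp_tree K v | v <- enum 'I_(gsize (hard_graph K eps true))]
   [seq comp_tree K v | v <- enum 'I_(gsize (hard_graph K eps false))].
rewrite /TMD sE; apply: (@le_trans _ _ (\sum_(j < n) D * n.+1%:R ^+ K)).
  apply: ler_sum => j _.
  have [a1 a2] := all_ok true j; have [b1 b2] := all_ok false (s j).
  apply: le_trans (TDfuel_le _ D0 Pz hD a1 b1) _.
  by rewrite ler_wpM2l // ler_weXn2l ?ler1n // geq_max a2 b2.
by rewrite sumr_const card_ord -[X in X <= _]mulr_natl.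
Qed.

End HardPairDistance.

(** * Propagation of the gap through the layers *)

Section CoreEstimates.
Variables (R : realType) (K : nat).

Lemma Forall_seq_in (X : eqType) (P : X -> Prop) (s : seq X) x :
  Forall_seq P s -> x \in s -> P x.
Proof.
elim: s => //= y s IH [Py Ps]; rewrite inE => /orP[/eqP -> //|]; exact: IH.
Qed.

Lemma dotv_sub_le d (a x y : seq R) (del : R) : unit_box d a ->
  (forall k, `|x`_k - y`_k| <= del) -> `|dotv a x - dotv a y| <= d%:R * del.
Proof.
move=> [sa a1] xy; rewrite /dotv -sumrB sa.
apply: le_trans (ler_norm_sum _ _ _) _.
apply: (@le_trans _ _ (\sum_(i < d) del)); last first.
  by rewrite sumr_const card_ord -[X in X <= _]mulr_natl.
apply: ler_sum => i _; rewrite -mulrBr normrM.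
by apply: le_trans (xy i); rewrite ler_piMl.
Qed.

Lemma dotv_le d (a x : seq R) (M : R) : unit_box d a ->
  (forall k, `|x`_k| <= M) -> `|dotv a x| <= d%:R * M.
Proof.
move=> ha hx; have -> : dotv a x = dotv a x - dotv a [::].
  by rewrite [X in _ - X]big1 ?subr0 // => i _; rewrite nth_nil mulr0.
by apply: dotv_sub_le => // k; rewrite nth_nil subr0.
Qed.

Lemma dotv_mid (a x y w : seq R) : (forall k, x`_k + y`_k = 2 * w`_k) ->
  dotv a x + dotv a y = 2 * dotv a w.
Proof.
move=> h; rewrite /dotv mulr_sumr -big_split; apply: eq_bigr => i _ /=.
by rewrite -mulrDr h mulrCA.
Qed.

(** Here [s.2 true] holds the states of the pair G_j and [s.2 false] those of H_j, whose common
    state is the midpoint of the former; [del] bounds the gap. *)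
Definition core_ok (M del : R) (s : mp_core (seq R)) : Prop :=
  [/\ forall l k, `|(s.1 l)`_k| <= M,
      forall c d k, `|(s.2 c d)`_k| <= M,
      s.2 false true = s.2 false false,
      forall k, (s.2 true true)`_k + (s.2 true false)`_k = 2 * (s.2 false false)`_k &
      forall k, `|(s.2 true true)`_k - (s.2 false false)`_k| <= del].

(** By the midpoint property the gap is a second difference of [rho]: [u] is the argument at the
    midpoint and [t] the step, and [|u|] is the distance of the bias from its critical value. *)
Lemma readout_gapE (rho : R -> R) d B ab M del s :
  core_ok M del s -> ball_box d B ab ->
  exists u t : R, [/\ `|ab.2 - dotv ab.1 (s.2 false false)| = `|u|,
    `|t| <= d%:R * del,
    [/\ `|u| <= d%:R * M + B, `|u + t| <= d%:R * M + B & `|u - t| <= d%:R * M + B] &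
    readout_gap rho ab s = rho (u + t) + rho (u - t) - 2 * rho u].
Proof.
move=> [_ hM h1 h2 h3] [ha hb]; case: ab ha hb => a b /= ha hb.
have bd k e : `|dotv a (s.2 k e) - b| <= d%:R * M + B.
  by apply: le_trans (ler_normB _ _) _; rewrite lerD // dotv_le.
exists (dotv a (s.2 false false) - b), (dotv a (s.2 true true) - dotv a (s.2 false false)).
have mid := dotv_mid a h2.
have E1 : dotv a (s.2 false false) - b + (dotv a (s.2 true true) - dotv a (s.2 false false))
  = dotv a (s.2 true true) - b by lra.
have E2 : dotv a (s.2 false false) - b - (dotv a (s.2 true true) - dotv a (s.2 false false))
  = dotv a (s.2 true false) - b by lra.
split; first by rewrite distrC.
- exact: dotv_sub_le.
- by rewrite E1 E2.
- by rewrite E1 E2 /readout_gap !big_bool /= h1; lra.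
Qed.

(** The active level no longer distinguishes the two graphs, and no later layer can restore the
    difference. *)
Definition degenerate (X : Type) (s : mp_core X) : Prop :=
  forall c d, s.2 c d = s.2 false false.

Lemma readout_gap_degenerate (rho : R -> R) ab s : degenerate s -> readout_gap rho ab s = 0.
Proof. by move=> h; rewrite /readout_gap !big_bool /= !(h _ _) subrr. Qed.

(** If the aggregations over G_j and H_j agree, then so do those over G_j + G_j, H_j + H_j and G_j +
    H_j. *)
Lemma degenerate_step (rho : R -> R) i (q : layer_params R) s :
  (forall ab, ab \in q.1 -> readout_gap rho ab s = 0) ->
  degenerate (core_step K i (mpnn_mp_layer rho q) s).
Proof.
move=> h c d; rewrite /core_step /=; apply: eq_map => r; congr (dotv r (_ ++ _)).
rewrite -!map_comp; apply/eq_in_map => ab /h /eqP /=.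
rewrite /readout_gap !big_bool /= subr_eq0 => /eqP E.
by congr (_ + _); case: c; case: d => /=; rewrite ?E.
Qed.

Lemma degenerate_step_degenerate (rho : R -> R) i (q : layer_params R) s :
  degenerate s -> degenerate (core_step K i (mpnn_mp_layer rho q) s).
Proof. by move=> h; apply: degenerate_step => ab _; exact: readout_gap_degenerate. Qed.

Lemma degenerate_run (rho : R -> R) i (L : seq (layer_params R)) s :
  degenerate s -> degenerate (core_run K i [seq mpnn_mp_layer rho q | q <- L] s).
Proof.
by elim: L i s => [//|q L IH] i s h; apply: IH; exact: degenerate_step_degenerate.
Qed.

(** At most four children and four parents send messages of size at most [M1], whence [M + 8 * M1],
    and the combination of [e] coordinates has coefficients at most 1. For aggregations g and h the
    new midpoint is [g + h], between [2g] and [2h], at distance [|g - h|]. *)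
Lemma core_ok_step (rho : R -> R) i (q : layer_params R) s d e (B M M1 del gam : R) :
  0 <= M -> 0 <= M1 -> 0 <= gam ->
  core_ok M del s ->
  Forall_seq (ball_box d B) q.1 -> Forall_seq (unit_box e) q.2 ->
  (forall x, `|x| <= d%:R * M + B -> `|rho x| <= M1) ->
  (forall ab, ab \in q.1 -> `|readout_gap rho ab s| <= gam) ->
  core_ok (e%:R * (M + 8 * M1)) (e%:R * gam) (core_step K i (mpnn_mp_layer rho q) s).
Proof.
move=> M0 M10 g0 [h1 h2 h3 h4 h5] hq1 hq2 hrho hgam.
have msg ab x : ab \in q.1 -> (forall k, `|x`_k| <= M) -> `|rho (dotv ab.1 x - ab.2)| <= M1.
  move=> /(Forall_seq_in hq1)[ha hb] hx; apply: hrho.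
  by apply: le_trans (ler_normB _ _) _; rewrite lerD // dotv_le.
have msg4 ab x : ab \in q.1 -> (forall k, `|x`_k| <= M) ->
    `|rho (dotv ab.1 x - ab.2) *+ 4| <= 4 * M1.
  by move=> abq hx; rewrite normrMn -[X in X <= _]mulr_natl ler_wpM2l // msg.
have nth_q r : r \in q.2 -> unit_box e r by exact: Forall_seq_in.
(* An index out of range returns the default 0, so the property is also required at 0. *)
have nthE (F : seq R * R -> R) (G : R -> Prop) k : G 0 ->
    (forall ab, ab \in q.1 -> G (F ab)) -> G ([seq F ab | ab <- q.1]`_k).
  move=> G0 GF; have [kq|kq] := ltnP k (size q.1); last by rewrite nth_default ?size_map.
  by rewrite (nth_map ([::], 0)) //; apply: GF; rewrite mem_nth.
have nthE2 (F : seq R -> R) (G : R -> Prop) k : G 0 ->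
    (forall r, r \in q.2 -> G (F r)) -> G ([seq F r | r <- q.2]`_k).
  move=> G0 GF; have [kq|kq] := ltnP k (size q.2); last by rewrite nth_default ?size_map.
  by rewrite (nth_map [::]) //; apply: GF; rewrite mem_nth.
have MM0 : 0 <= M + 8 * M1 by lra.
have e0 : 0 <= e%:R :> R by exact: ler0n.
have cat_le (x : seq R) (F : seq R * R -> R) k : (forall k, `|x`_k| <= M) ->
    (forall ab, ab \in q.1 -> `|F ab| <= 8 * M1) ->
    `|(x ++ [seq F ab | ab <- q.1])`_k| <= M + 8 * M1.
  move=> hx hF; rewrite nth_cat; case: ifP => _; first by apply: le_trans (hx k) _; lra.
  apply: (nthE F (fun y => `|y| <= M + 8 * M1)); first by rewrite normr0.
  by move=> ab /hF h; apply: le_trans h _; lra.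
split.
- move=> l k; rewrite /core_step /=.
  apply: (nthE2 _ (fun y => `|y| <= _)); first by rewrite normr0 mulr_ge0.
  move=> r /nth_q hr; apply: dotv_le => // {}k; rewrite -map_comp; apply: cat_le => // ab hab /=.
  have -> : 8 * M1 = 4 * M1 + 4 * M1 by lra.
  apply: le_trans (ler_normD _ _) _; apply: lerD.
    by case: l => [|l]; [rewrite normr0; lra|exact: msg4].
  by case: ifP => _; [exact: msg4|rewrite normr0; lra].
- move=> c d' k; rewrite /core_step /=.
  apply: (nthE2 _ (fun y => `|y| <= _)); first by rewrite normr0 mulr_ge0.
  move=> r /nth_q hr; apply: dotv_le => // {}k; rewrite -map_comp; apply: cat_le => // ab hab /=.
  have -> : 8 * M1 = 4 * M1 + 4 * M1 by lra.
  apply: le_trans (ler_normD _ _) _; apply: lerD; last first.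
    by case: ifP => _; [exact: msg4|rewrite normr0; lra].
  rewrite !big_bool /=.
  have m1 c1 d1 := msg ab (s.2 c1 d1) hab (h2 c1 d1).
  have -> : 4 * M1 = (M1 + M1) + (M1 + M1) by lra.
  by do 2 (apply: le_trans (ler_normD _ _) _; apply: lerD).
- rewrite /core_step /=; apply: eq_map => r; congr (dotv r (_ ++ _)).
  by rewrite -!map_comp; apply: eq_map => ab /=; rewrite !big_bool /= [X in X + _]addrC.
- move=> k; rewrite /core_step /=.
  have [kq|kq] := ltnP k (size q.2); last by rewrite !nth_default ?size_map // addr0 mulr0.
  rewrite !(nth_map [::]) //; apply: dotv_mid => j.
  rewrite -!map_comp !nth_cat; case: ifP => _; first by lra.
  set j' := (j - _)%N.
  have [jq|jq] := ltnP j' (size q.1); last by rewrite !nth_default ?size_map // addr0 mulr0.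
  rewrite !(nth_map ([::], 0)) //= !big_bool /=; lra.
- move=> k; rewrite /core_step /=.
  have [kq|kq] := ltnP k (size q.2); last first.
    by rewrite !nth_default ?size_map // subrr normr0 mulr_ge0.
  rewrite !(nth_map [::]) //; apply: dotv_sub_le; first by apply: nth_q; rewrite mem_nth.
  move=> j; rewrite -!map_comp !nth_cat; case: ifP => _; first by rewrite subrr normr0.
  set j' := (j - _)%N.
  have [jq|jq] := ltnP j' (size q.1); last by rewrite !nth_default ?size_map // subrr normr0.
  have := hgam (nth ([::], 0) q.1 j') (mem_nth _ jq).
  rewrite !(nth_map ([::], 0)) //= /readout_gap !big_bool /=.
  (* The node of index [true] has children H_j + H_j, so the sign is opposite to that of
     [readout_gap]. *)
  by rewrite distrC; congr (`|_| <= _); lra.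
Qed.

Lemma core_ok_init eps : 0 <= eps <= 1 ->
  core_ok 1 eps (init_core (fun x : R => [:: x]) eps).
Proof.
move=> /andP[e0 e1]; split => /=.
- by move=> l [|[|k]] /=; rewrite normr0.
- by move=> [] [] [|[|k]] /=; rewrite ?normr0 ?normrN ?ger0_norm.
- by [].
- by move=> [|[|k]] /=; lra.
- by move=> [|[|k]] /=; rewrite ?subr0 ?normr0 ?normrN ?ger0_norm.
Qed.

Lemma pnorm_div_powR_le p (v : seq R) D gam : 1 <= p -> 0 < D -> 0 <= gam ->
  (forall k, (k < size v)%N -> `|v`_k| <= gam) ->
  (pnorm p v / D) `^ p <= (size v)%:R * gam `^ p * D^-1 `^ p.
Proof.
move=> p1 D0 g0 hv; have p0 : 0 < p by lra.
have S0 : 0 <= \sum_(i < size v) `|v`_i| `^ p by apply: sumr_ge0 => i _; exact: powR_ge0.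
rewrite powRM ?invr_ge0 ?(ltW D0) ?powR_ge0 //.
apply: ler_wpM2r; first exact: powR_ge0.
rewrite /pnorm -powRrM mulVf ?gt_eqF // powRr1 //.
apply: (@le_trans _ _ (\sum_(i < size v) gam `^ p)); last first.
  by rewrite sumr_const card_ord -[X in X <= _]mulr_natl.
apply: ler_sum => i _; apply: ge0_ler_powR; [exact: ltW|by rewrite nnegrE|by rewrite nnegrE|exact: hv].
Qed.

End CoreEstimates.

(** * Second differences of the activation functions *)

Section Activations.
Variable R : realType.

Lemma relu_le (x : R) : `|relu x| <= `|x|.
Proof. by rewrite /relu; case: (lerP x 0) => h; rewrite ?normr0. Qed.

(** The three arguments lie on the same side of the kink, where ReLU is affine. *)
Lemma relu_second_diff_eq0 (u t : R) : `|t| < `|u| ->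
  relu (u + t) + relu (u - t) - 2 * relu u = 0.
Proof.
move=> h; have h1 := ler_norm t; have h2 := ler_norm (- t); rewrite normrN in h2.
rewrite /relu; case: (lerP 0 u) h => [u0|u0]; [rewrite (ger0_norm u0)|rewrite (ltr0_norm u0)] => h.
  by rewrite !max_l; lra.
by rewrite !max_r; lra.
Qed.

Lemma relu_second_diff_le (u t : R) :
  `|relu (u + t) + relu (u - t) - 2 * relu u| <= 2 * `|t|.
Proof.
have h1 := ler_norm t; have h2 := ler_norm (- t); rewrite normrN in h2.
rewrite ler_norml /relu; case: (lerP (u + t) 0) => a; case: (lerP (u - t) 0) => b;
  case: (lerP u 0) => c; lra.
Qed.

Lemma derivable_within_segment (f : R -> R) (a b : R) :
  (forall x, derivable f x 1) -> {within `[a, b], continuous f}.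
Proof.
move=> df; apply: continuous_subspaceT => x.
exact/differentiable_continuous/derivable1_diffP.
Qed.

Lemma derivable_bounded (f : R -> R) (M : R) : (forall x, derivable f x 1) ->
  exists2 M1, 0 <= M1 & forall x, `|x| <= M -> `|f x| <= M1.
Proof.
move=> df; have [M0|M0] := leP 0 M; last first.
  by exists 0 => // x hx; have := normr_ge0 x; lra.
have cf := @derivable_within_segment f (- M) M df.
have MM : - M <= M by lra.
have [c _ hc] := EVT_max MM cf; have [d _ hd] := EVT_min MM cf.
exists (`|f c| + `|f d|) => [|x hx]; first by rewrite addr_ge0.
have xM : x \in `[- M, M]%R by rewrite in_itv /= -ler_norml.
have := hc _ xM; have := hd _ xM; have := ler_norm (f c).
have := ler_norm (- f d); rewrite normrN => h1 h2 h3 h4.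
by rewrite ler_norml; have := normr_ge0 (f c); have := normr_ge0 (f d); lra.
Qed.

Lemma derivable_lip (f : R -> R) (M L a b : R) : (forall x, derivable f x 1) ->
  (forall x, `|x| <= M -> `|derive1 f x| <= L) -> `|a| <= M -> `|b| <= M ->
  `|f b - f a| <= L * `|b - a|.
Proof.
move=> df hL; wlog ab : a b / a <= b.
  move=> H aM bM; have [ab|/ltW ba] := leP a b; first exact: H.
  by rewrite distrC [X in L * X]distrC; exact: H.
move=> aM bM.
have [||c cab ->] := @MVT_segment R f (derive1 f) a b ab.
- by move=> x _; rewrite derive1E; exact: DeriveDef.
- exact: derivable_within_segment.
rewrite normrM ler_wpM2r //; apply: hL; move: cab; rewrite in_itv /= => /andP[ac cb].
by move: aM bM; rewrite !ler_norml => /andP[? ?] /andP[? ?]; apply/andP; split; lra.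
Qed.

(** Two mean values turn the second difference into [(rho' c1 - rho' c2) t] with [|c1 - c2| <= 2 t],
    and [rho'] is Lipschitz on the compact interval. *)
Lemma smooth_second_diff_le (rho : R -> R) (M : R) : smooth rho -> exists2 S, 0 <= S &
  forall u t, `|u| <= M -> `|u + t| <= M -> `|u - t| <= M ->
  `|rho (u + t) + rho (u - t) - 2 * rho u| <= S * t ^+ 2.
Proof.
move=> smooth_rho; have d0 x : derivable rho x 1 := smooth_rho 0%N x.
have d1 x : derivable (derive1 rho) x 1 := smooth_rho 1%N x.
have d2 x : derivable (derive1 (derive1 rho)) x 1 := smooth_rho 2%N x.
have [L L0 hL] := derivable_bounded M d2.
exists (2 * L) => [|u t]; first by lra.
wlog t0 : t / 0 <= t.
  move=> H uM p m; have [t0|t0] := leP 0 t; first exact: H.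
  have := H (- t) _ uM; rewrite opprK sqrrN => H'.
  by rewrite [rho (u + t) + _]addrC; apply: H' => //; lra.
move=> uM pM mM.
have isd x (_ : x \in `]u, (u + t)[%R) : is_derive x 1 rho (derive1 rho x).
  by rewrite derive1E; exact: DeriveDef.
have isd' x (_ : x \in `]u - t, u[%R) : is_derive x 1 rho (derive1 rho x).
  by rewrite derive1E; exact: DeriveDef.
have le1 : u <= u + t by lra.
have le2 : u - t <= u by lra.
have [c1 + e1] := MVT_segment le1 isd (derivable_within_segment d0).
have [c2 + e2] := MVT_segment le2 isd' (derivable_within_segment d0).
rewrite !in_itv /= => /andP[a1 b1] /andP[a2 b2].
have -> : rho (u + t) + rho (u - t) - 2 * rho u = (derive1 rho c1 - derive1 rho c2) * t.
  have -> : rho (u + t) + rho (u - t) - 2 * rho u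
    = (rho (u + t) - rho u) - (rho u - rho (u - t)) by lra.
  by rewrite e1 e2; ring.
have [? ?] : - M <= u + t /\ u + t <= M by apply/andP; rewrite -ler_norml.
have [? ?] : - M <= u - t /\ u - t <= M by apply/andP; rewrite -ler_norml.
rewrite normrM (ger0_norm t0) expr2 mulrA; apply: ler_wpM2r => //.
have h12 : `|derive1 rho c1 - derive1 rho c2| <= L * `|c1 - c2|.
  by apply: (derivable_lip d1 hL); rewrite ler_norml; apply/andP; split; lra.
apply: le_trans h12 _; rewrite [2 * L]mulrC -mulrA ler_wpM2l //.
by rewrite ler_norml; apply/andP; split; lra.
Qed.

End Activations.

(** * Expectations over the parameters of the network *)

Section Network.
Variables (R : realType) (K : nat) (p B : R) (w dm : nat -> nat) (wout : nat).
Hypotheses (p1 : 1 <= p) (B0 : 0 < B).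
Local Open Scope ereal_scope.

(** Here [i] counts the layers already passed, so the head of the list is layer [i.+1] with input
    dimension [hdim dm i]. *)
Fixpoint layers_ok (i : nat) (L : seq (layer_params R)) : Prop :=
  if L is q :: L' then
    [/\ Forall_seq (ball_box (hdim dm i) B) q.1,
        Forall_seq (unit_box (hdim dm i + w i.+1)) q.2 & layers_ok i.+1 L']
  else True.

Let draw_ge0 d : forall f : seq R * R -> \bar R, (forall x, 0 <= f x) -> 0 <= drawAB d B f.
Proof. by move=> f f0; exact: drawAB_ge0. Qed.

Let sphere_ge0 d : forall f : seq R -> \bar R, (forall x, 0 <= f x) -> 0 <= Esphere d f.
Proof. by move=> f f0; exact: Esphere_ge0. Qed.

Lemma Elayers_ge0 rem i (g : seq (layer_params R) -> \bar R) :
  (forall L, 0 <= g L) -> 0 <= Elayers B w dm rem i g.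
Proof.
elim: rem i g => [|rem IH] i g g0 /=; first exact: g0.
apply: Ecopies_ge0; first exact: draw_ge0.
by move=> P; apply: Ecopies_ge0; [exact: sphere_ge0|move=> Q; exact: IH].
Qed.

Lemma readout_le d m (g : seq (seq R * R) -> \bar R) (M : R) : (0 <= M)%R ->
  (forall P, 0 <= g P) ->
  (forall P, size P = m -> Forall_seq (ball_box d B) P -> g P <= M%:E) ->
  Ecopies m (drawAB d B) g <= M%:E.
Proof.
move=> M0 g0 gM; apply: (Ecopies_le (P := ball_box d B)) => //; first exact: draw_ge0.
move=> f f0 fM.
have -> : M = (M + 0 * (0 / B))%R by rewrite mul0r addr0.
apply: (drawAB_le (m := fun=> 0%R)) => // ab hab.
by apply: le_trans (fM _ hab) _; rewrite addr0 if_same.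
Qed.

Lemma combine_le e m (g : seq (seq R) -> \bar R) (M : R) : (0 <= M)%R ->
  (forall Q, 0 <= g Q) ->
  (forall Q, size Q = m -> Forall_seq (unit_box e) Q -> g Q <= M%:E) ->
  Ecopies m (Esphere e) g <= M%:E.
Proof.
move=> M0 g0 gM; apply: (Ecopies_le (P := unit_box e)) => //; first exact: sphere_ge0.
move=> f f0 fM; exact: Esphere_le.
Qed.

Lemma Elayers_le rem i (g : seq (layer_params R) -> \bar R) (M : R) : (0 <= M)%R ->
  (forall L, 0 <= g L) ->
  (forall L, size L = rem -> layers_ok i L -> g L <= M%:E) ->
  Elayers B w dm rem i.+1 g <= M%:E.
Proof.
move=> M0; elim: rem i g => [|rem IH] i g g0 gM /=; first exact: gM.
apply: readout_le => //.
  by move=> P; apply: Ecopies_ge0; [exact: sphere_ge0|move=> Q; exact: Elayers_ge0].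
move=> P sP hP; apply: combine_le => //; first by move=> Q; exact: Elayers_ge0.
move=> Q sQ hQ; apply: IH => // L sL hL; apply: gM => //=; by rewrite sL.
Qed.

Local Close Scope ereal_scope.

(* Each layer contributes a factor eps: unless the bias of some copy falls within
   O(eps) of the kink of the ReLU, the two graphs become indistinguishable for
   all later layers. *)
Lemma relu_Elayers_le rem i (M C : R) : 0 <= M -> 0 <= C ->
  exists2 C', 0 <= C' & forall eps D s (g : seq (layer_params R) -> seq (seq R * R) -> \bar R),
  0 < eps <= 1 -> 0 < D -> core_ok M (C * eps) s ->
  (forall L P, 0 <= g L P)%E ->
  (forall L P, size L = rem -> size P = wout -> g L P =
    ((pnorm p [seq readout_gap (@relu R) ab
       (core_run K i [seq mpnn_mp_layer (@relu R) q | q <- L] s) *+ 4 | ab <- P] / D) `^ p)%:E) ->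
  (Elayers B w dm rem i.+1 (fun L => Ecopies wout (drawAB (hdim dm (i + rem)) B) (g L))
    <= (C' * (eps `^ p * eps ^+ rem.+1 * D^-1 `^ p))%:E)%E.
Proof.
have p0 : p != 0 by rewrite gt_eqF // (lt_le_trans ltr01 p1).
move=> M0; elim: rem i M C M0 => [|rem IH] i M C M0 C0.
  set d : R := (hdim dm i)%:R; have d0 : 0 <= d by exact: ler0n.
  have dC0 : 0 <= d * C by exact: mulr_ge0.
  (* The 8 is the multiplicity 4 of the readout times the 2 of [relu_second_diff_le]; the last
     factor is the union bound over the [wout] biases, up to [eps]. *)
  exists (wout%:R * (8 * (d * C)) `^ p * (wout%:R * (d * C / B))).
    by rewrite !mulr_ge0 // ?powR_ge0 // ltW // invr_gt0.
  move=> eps D s g /andP[e0 e1] D0 ok g0 gE; rewrite /= addn0.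
  have e00 := ltW e0; have De0 : 0 <= d * (C * eps) by rewrite !mulr_ge0.
  apply: le_trans (Ecopies_drawAB_le (m := fun a => dotv a (s.2 false false))
    (M := wout%:R * (8 * (d * (C * eps))) `^ p * D^-1 `^ p) (r := d * (C * eps)) _ _ _ _ _) _ => //.
  - by rewrite !mulr_ge0 // powR_ge0.
  - move=> P sP hP; rewrite gE //= lee_fin.
    set v := map _ _; have sv : size v = wout by rewrite size_map.
    have vE k : (k < size v)%N -> exists2 ab, ab \in P & v`_k = readout_gap (@relu R) ab s *+ 4.
      rewrite size_map => kP; exists (nth ([::], 0) P k); first exact: mem_nth.
      by rewrite (nth_map ([::], 0)).
    case: ifPn => [_|/hasPn nb].
      rewrite -sv; apply: pnorm_div_powR_le => //; first by lra.
      move=> k /vE[ab abP ->].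
      have [u [t [_ ht _ ->]]] := readout_gapE (@relu R) ok (Forall_seq_in hP abP).
      have := relu_second_diff_le u t => h; rewrite -/d in ht.
      by rewrite normrMn -[X in X <= _]mulr_natl; lra.
    (* With no exceptional bias all entries vanish, which is the norm bound with [gam = 0]. *)
    have -> : 0 = (size v)%:R * 0 `^ p * D^-1 `^ p :> R by rewrite powR0 // mulr0 mul0r.
    apply: pnorm_div_powR_le => // k /vE[ab abP ->].
    have [u [t [hu ht _ ->]]] := readout_gapE (@relu R) ok (Forall_seq_in hP abP).
    rewrite relu_second_diff_eq0 ?mul0rn ?normr0 //.
    by have := nb _ abP; rewrite -ltNge hu; apply: le_lt_trans.
  - rewrite lee_fin.
    have -> : 8 * (d * (C * eps)) = 8 * (d * C) * eps by ring.
    rewrite powRM ?mulr_ge0 // expr1 le_eqVlt; apply/orP; left; apply/eqP.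
    by field; rewrite gt_eqF.
set d : R := (hdim dm i)%:R; have d0 : 0 <= d by exact: ler0n.
set e : R := (hdim dm i + w i.+1)%:R; have e_0 : 0 <= e by exact: ler0n.
have dC0 : 0 <= d * C by exact: mulr_ge0.
have M1_0 : 0 <= d * M + B by rewrite addr_ge0 ?mulr_ge0 // ltW.
have M'0 : 0 <= e * (M + 8 * (d * M + B)) by rewrite mulr_ge0 //; lra.
have C'0 : 0 <= e * (2 * (d * C)) by rewrite mulr_ge0 //; lra.
have [C2 C20 HC2] := IH i.+1 _ _ M'0 C'0.
(* The new factor is the union bound over the aggregation biases of this layer, up to [eps]. *)
exists (C2 * ((w i.+1)%:R * (d * C / B))).
  by rewrite !mulr_ge0 // ltW // invr_gt0.
move=> eps D s g /andP[e0 e1] D0 ok g0 gE; rewrite /= -addSnnS.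
have e00 := ltW e0; have De0 : 0 <= d * (C * eps) by rewrite !mulr_ge0.
have X0 : 0 <= C2 * (eps `^ p * eps ^+ rem.+1 * D^-1 `^ p).
  by rewrite !mulr_ge0 // ?powR_ge0 // exprn_ge0.
have EC0 L : (0 <= Ecopies wout (drawAB (hdim dm (i.+1 + rem)) B) (g L))%E.
  by apply: Ecopies_ge0 => // f; exact: drawAB_ge0.
have EL0 P Q : (0 <= Elayers B w dm rem i.+2 (fun L =>
    Ecopies wout (drawAB (hdim dm (i.+1 + rem)) B) (g ((P, Q) :: L))))%E.
  by apply: Elayers_ge0.
apply: le_trans (Ecopies_drawAB_le (m := fun a => dotv a (s.2 false false))
  (M := C2 * (eps `^ p * eps ^+ rem.+1 * D^-1 `^ p)) (r := d * (C * eps)) _ _ _ _ _) _ => //.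
- by move=> P; apply: Ecopies_ge0 => // f; exact: Esphere_ge0.
(* If some bias is exceptional, the induction hypothesis bounds the remaining expectation; otherwise
   the state becomes degenerate and the integrand is 0. *)
- move=> P sP hP; case: ifPn => [_|/hasPn nb].
    apply: combine_le => // Q sQ hQ.
    apply: (HC2 eps D (core_step K i (mpnn_mp_layer (@relu R) (P, Q)) s)) => //.
    + by rewrite e0.
    + have -> : e * (2 * (d * C)) * eps = e * (2 * (d * (C * eps))) by ring.
      apply: (core_ok_step K i (q := (P, Q)) M0 M1_0 _ ok hP hQ); first by rewrite mulr_ge0.
        by move=> x; apply: le_trans; exact: relu_le.
      move=> ab abP; have [u [t [hu ht _ ->]]] := readout_gapE (@relu R) ok (Forall_seq_in hP abP).
      by apply: le_trans (relu_second_diff_le u t) _; rewrite ler_wpM2l.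
    + by move=> L P' sL sP'; rewrite gE //= sL.
  apply: combine_le => // Q sQ hQ; apply: Elayers_le => // L sL _.
  apply: readout_le => // P' sP' _; rewrite gE //= ?sL // lee_fin.
  set v := map _ _.
  have -> : 0 = (size v)%:R * 0 `^ p * D^-1 `^ p :> R by rewrite powR0 // mulr0 mul0r.
  apply: pnorm_div_powR_le => // k; rewrite size_map => kP.
  rewrite (nth_map ([::], 0)) // readout_gap_degenerate ?mul0rn ?normr0 //.
  apply: degenerate_run; apply: degenerate_step => ab abP.
  have [u [t [hu ht _ ->]]] := readout_gapE (@relu R) ok (Forall_seq_in hP abP).
  apply: relu_second_diff_eq0.
  by have := nb _ abP; rewrite -ltNge hu; apply: le_lt_trans.
- rewrite lee_fin [eps ^+ rem.+2]exprS le_eqVlt; apply/orP; left; apply/eqP.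
  by field; rewrite gt_eqF.
Qed.

(** Holds for every draw of bounded parameters: the second difference squares the gap at each layer,
    which doubles the power of [eps]. *)
Lemma smooth_core_ok_run (rho : R -> R) rem i (M C : R) : smooth rho -> 0 <= M -> 0 <= C ->
  exists M' C', [/\ 0 <= M', 0 <= C' & forall eps L s, 0 <= eps ->
    size L = rem -> layers_ok i L -> core_ok M (C * eps ^+ (2 ^ i)) s ->
    core_ok M' (C' * eps ^+ (2 ^ (i + rem)))
      (core_run K i [seq mpnn_mp_layer rho q | q <- L] s)].
Proof.
move=> srho; elim: rem i M C => [|rem IH] i M C M0 C0.
  by exists M, C; split => // eps [] // s e0 _ _; rewrite addn0.
set d : R := (hdim dm i)%:R; have d0 : 0 <= d by exact: ler0n.
set e : R := (hdim dm i + w i.+1)%:R; have e_0 : 0 <= e by exact: ler0n.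
have [M1 M10 hM1] := derivable_bounded (d * M + B) (srho 0%N).
have [S S0 hS] := smooth_second_diff_le (d * M + B) srho.
have M'0 : 0 <= e * (M + 8 * M1) by rewrite mulr_ge0 //; lra.
have C'0 : 0 <= e * (S * (d * C) ^+ 2) by rewrite !mulr_ge0 // exprn_ge0 // mulr_ge0.
have [M' [C' [M'1 C'1 H]]] := IH i.+1 _ _ M'0 C'0.
exists M', C'; split=> // eps [//|q L] s e0 /= [sL] [hq1 hq2 hL] ok.
rewrite -addSnnS; apply: H => //.
have -> : e * (S * (d * C) ^+ 2) * eps ^+ (2 ^ i.+1) = e * (S * (d * (C * eps ^+ (2 ^ i))) ^+ 2).
  by rewrite expnS mulnC exprM; ring.
apply: (core_ok_step K i M0 M10 _ ok hq1 hq2 hM1).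
  by rewrite mulr_ge0 // sqr_ge0.
move=> ab abP; have [u [t [_ ht [h1 h2 h3] ->]]] := readout_gapE rho ok (Forall_seq_in hq1 abP).
apply: le_trans (hS u t h1 h2 h3) _; rewrite ler_wpM2l // -(real_normK (num_real t)).
by rewrite ler_pXn2r // nnegrE // (le_trans _ ht).
Qed.

End Network.

(** * Lower bound on the Hölder exponent *)

Section Exponent.
Variable R : realType.

(** If [alpha < q], the right-hand side is of order [eps^(p (q - max(alpha, 0)))] and tends to 0,
    against the positive [c^p]. *)
Lemma exponent_ge (p q alpha c A T e0 : R) :
  1 <= p -> 0 < q -> 0 < c -> 0 <= A -> 0 < e0 -> 0 < T ->
  (forall eps, 0 < eps <= e0 -> exists d, [/\ eps <= d, d <= T &
     c `^ p <= A * (eps `^ (p * q) * (d `^ alpha)^-1 `^ p)]) ->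
  q <= alpha.
Proof.
move=> p1 q0 c0 A0 e00 T0 H; have [//|aq] := leP q alpha; exfalso.
have p0 : 0 < p by lra.
set be := Num.max alpha 0.
have bq : 0 < q - be by rewrite subr_gt0 gt_max aq.
(* The 1 serves [alpha >= 0], where [d >= eps] is used; the other summand serves [alpha < 0], where
   [d <= T] is used. *)
set T' := 1 + T `^ (- alpha).
have T'0 : 0 < T' by rewrite ltr_wpDr // powR_ge0.
have dE eps d : 0 < eps -> eps <= d -> d <= T -> (d `^ alpha)^-1 <= T' * eps `^ (- be).
  move=> e1 ed dT; have d0 : 0 < d by lra.
  rewrite -powRN /be; have [a0|a0] := leP 0 alpha.
    apply: (@le_trans _ _ (eps `^ (- alpha))).
      rewrite !powRN lef_pV2 ?posrE ?powR_gt0 //.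
      by apply: ge0_ler_powR; rewrite ?nnegrE ?(ltW e1) ?(ltW d0).
    by rewrite ler_peMl ?powR_ge0 // /T' lerDl powR_ge0.
  rewrite oppr0 powRr0 mulr1 /T'.
  apply: (@le_trans _ _ (T `^ (- alpha))); last by rewrite lerDr.
  by apply: ge0_ler_powR; rewrite ?nnegrE ?(ltW d0) ?(ltW T0) //; lra.
set A' := A * T' `^ p + 1.
have A'0 : 0 < A' by rewrite ltr_wpDl // mulr_ge0 // powR_ge0.
set eta := p * (q - be); have eta0 : 0 < eta by exact: mulr_gt0.
have cp0 : 0 < c `^ p by exact: powR_gt0.
(* Chosen so that [A' * y] is half of [c^p]; then [eps] is taken with [eps^eta <= y]. *)
set y := c `^ p / (2 * A'); have y0 : 0 < y by rewrite divr_gt0 // mulr_gt0.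
set eps := Num.min e0 (y `^ eta^-1).
have eps0 : 0 < eps by rewrite lt_min e00 powR_gt0.
have [|d [ed dT]] := H eps; first by rewrite eps0 /eps ge_min lexx.
apply/negP; rewrite -ltNge.
have ey : eps `^ eta <= y.
  apply: (@le_trans _ _ ((y `^ eta^-1) `^ eta)).
    apply: ge0_ler_powR; rewrite ?nnegrE ?powR_ge0 ?(ltW eta0) ?(ltW eps0) //.
    by rewrite /eps ge_min lexx orbT.
  by rewrite -powRrM mulVf ?gt_eqF // powRr1 // ltW.
apply: (@le_lt_trans _ _ (A' * y)); last first.
  rewrite /y; have -> : A' * (c `^ p / (2 * A')) = c `^ p / 2 by field; rewrite gt_eqF.
  lra.
apply: (@le_trans _ _ (A' * eps `^ eta)); last by rewrite ler_pM2l.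
apply: (@le_trans _ _ (A * (eps `^ (p * q) * (T' * eps `^ (- be)) `^ p))).
  apply: ler_wpM2l => //; apply: ler_wpM2l; first exact: powR_ge0.
  apply: ge0_ler_powR; [exact: ltW| | |exact: dE].
    by rewrite nnegrE invr_ge0 powR_ge0.
  by rewrite nnegrE mulr_ge0 ?powR_ge0 // ltW.
have -> : eps `^ (p * q) * (T' * eps `^ (- be)) `^ p = T' `^ p * eps `^ eta.
  rewrite powRM ?powR_ge0 ?(ltW T'0) // -powRrM mulrCA -powRD; last first.
    by apply/implyP => _; rewrite gt_eqF.
  by congr (_ * _ `^ _); rewrite /eta; ring.
by rewrite mulrA ler_wpM2r ?powR_ge0 // /A' lerDl.
Qed.

End Exponent.

Section HolderBound.
Variables (R : realType) (K : nat) (p B : R) (w dm : nat -> nat) (wout : nat).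
Variables (Omega : set R) (z e : R) (n : nat).
Hypotheses (p1 : 1 <= p) (B0 : 0 < B) (e0 : 0 < e) (eO : `]-e, e[ `<=` Omega).
Hypotheses (zO : ~ Omega z) (Kn : (8 * K.+1 <= n)%N).

Lemma hard_graph_in_Gle eps k0 : 0 <= eps -> eps < e -> in_Gle n Omega (hard_graph K eps k0).
Proof.
move=> ep0 ee; split.
- by rewrite /= card_vtx.
- by move=> u v /=; exact: vadj_sym.
- by move=> v /=; exact: vadj_irr.
move=> v; apply: eO; rewrite /= in_itv /=.
by have := leaf_feat_le K k0 (enum_val v).1 (enum_val v).2 ep0; rewrite ler_norml; lra.
Qed.

(** Reduces both activations to an upper bound for the expectation on the hard pair. The integrand
    is an arbitrary nonnegative [g], prescribed only on parameter lists of the right lengths. *)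
Lemma lower_holder_exponent_ge (rho : R -> R) q A alpha :
  0 < q -> 0 <= A ->
  (forall eps D (g : mpnn_params R -> \bar R), 0 < eps <= 1 -> 0 < D ->
    (forall prm, 0 <= g prm)%E ->
    (forall L P, size L = K -> size P = wout -> g (L, P) =
      ((pnorm p [seq readout_gap rho ab (mpnn_core K rho eps L) *+ 4 | ab <- P] / D) `^ p)%:E) ->
    (Enet B K w dm wout g <= (A * (eps `^ (p * q) * D^-1 `^ p))%:E)%E) ->
  lower_holder_exp (Enet B K w dm wout) (mpnn rho) (in_Gle n Omega) (TMD n z K) p alpha ->
  q <= alpha.
Proof.
move=> q0 A0 hA [c [c0 hc]].
have ez : e <= `|z|.
  rewrite leNgt; apply/negP => ze; apply: zO; apply: eO.
  by rewrite /= in_itv /= -ltr_norml.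
pose T : R := n%:R * (2 * (1 + `|z|) * n.+1%:R ^+ K).
have n0 : 0 < n%:R :> R.
  by rewrite ltr0n; apply: leq_trans Kn; rewrite muln_gt0.
have T0 : 0 < T by rewrite /T mulr_gt0 // mulr_gt0 ?exprn_gt0 ?mulr_gt0 // ltr_pwDl.
(* With [eps <= e / 2] the features stay in [Omega] and, since [e <= |z|], also [2 * eps <= |z|]. *)
have e2 : 0 < Num.min 1 (e / 2) by rewrite lt_min ltr01 divr_gt0.
apply: (exponent_ge p1 q0 c0 A0 e2 T0) => eps; rewrite le_min => /and3P[ep0 ep1 epe].
set d := TMD n z K (hard_graph K eps true) (hard_graph K eps false).
have dge : eps <= d by apply: TMD_hard_ge Kn => //; lra.
have dle : d <= T by apply: TMD_hard_le Kn; rewrite ltW.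
have d0 : 0 < d by lra.
exists d; split=> //.
have inG k0 : in_Gle n Omega (hard_graph K eps k0) by apply: hard_graph_in_Gle; lra.
rewrite -lee_fin; apply: le_trans (hc _ _ (inG true) (inG false) d0) _.
apply: hA; first by rewrite ep0.
- exact: powR_gt0.
- by move=> prm; rewrite lee_fin powR_ge0.
- by move=> L P sL sP; rewrite mpnn_hard_diff.
Qed.

End HolderBound.

Theorem mainTheorem14 (R : realType) (K : nat) :
  exists N : nat,
  forall (p B : R) (Omega : set R) (z : R) (n : nat),
    1 <= p -> 0 < B ->
    compact Omega -> (exists e : R, 0 < e /\ `]-e, e[ `<=` Omega) ->
    ~ Omega z -> (N <= n)%N ->
    forall (w dm : nat -> nat) (wout : nat),
      (forall k, (1 <= k <= K)%N -> (0 < w k)%N /\ (0 < dm k)%N) ->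
      (0 < wout)%N ->
      forall alpha : R,
        (lower_holder_exp (Enet B K w dm wout) (mpnn (@relu R))
           (in_Gle n Omega) (TMD n z K) p alpha ->
         1 + K.+1%:R / p <= alpha)
        /\
        (forall rho : R -> R, smooth rho ->
         lower_holder_exp (Enet B K w dm wout) (mpnn rho)
           (in_Gle n Omega) (TMD n z K) p alpha ->
         2 ^+ K.+1 <= alpha).
Proof.
(* The number of nodes of a hard graph: eight tags on each of [K.+1] levels. *)
exists (8 * K.+1)%N => p B Omega z n p1 B0 _ [e [e0 eO]] zO Kn w dm wout _ _ alpha.
have p0 : 0 < p by lra.
split=> [|rho srho].
  (* On level 0 the states are bounded by 1 and the gap is [eps], so [M = C = 1]. *)
  have [A A0 hA] := @relu_Elayers_le R K p B w dm wout p1 B0 K 0 1 1 ler01 ler01.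
  apply: (lower_holder_exponent_ge p1 e0 eO zO Kn _ A0).
    by rewrite ltr_pwDl // divr_ge0 // ltW.
  move=> eps D g he D0 g0 gE.
  (* The factor [eps^p] is the size of the gap, and each of the [K.+1] random bias events gives one
     more [eps]. *)
  have -> : eps `^ (p * (1 + K.+1%:R / p)) = eps `^ p * eps ^+ K.+1.
    have -> : p * (1 + K.+1%:R / p) = p + K.+1%:R by field; rewrite gt_eqF.
    have ep0 : 0 < eps by case/andP: he.
    rewrite powRD ?powR_mulrn ?ltW //.
    by apply/implyP => _; rewrite gt_eqF.
  apply: (hA eps D (init_core (fun x => [:: x]) eps) (fun L P => g (L, P)) he D0).
  - by rewrite mul1r; apply: core_ok_init; case/andP: he => /ltW -> ->.
  - by move=> L P; exact: g0.
  - exact: gE.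
have [M [C [M0 C0 hMC]]] := smooth_core_ok_run K B w dm K 0 srho (@ler01 R) (@ler01 R).
set d : R := (hdim dm K)%:R; have d0 : 0 <= d by exact: ler0n.
have [S S0 hS] := smooth_second_diff_le (d * M + B) srho.
(* The 4 is the readout multiplicity; the readout is one more second difference and squares the gap
   [C * eps^(2^K)]. *)
pose G := 4 * (S * (d * C) ^+ 2).
have G0 : 0 <= G by rewrite /G mulr_ge0 // mulr_ge0 // exprn_ge0 // mulr_ge0.
apply: (lower_holder_exponent_ge p1 e0 eO zO Kn (A := wout%:R * G `^ p)).
- exact: exprn_gt0.
- by rewrite mulr_ge0 // powR_ge0.
move=> eps D g /andP[ep0 ep1] D0 g0 gE.
have bnd0 : 0 <= wout%:R * G `^ p * (eps `^ (p * 2 ^+ K.+1) * D^-1 `^ p).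
  by rewrite mulr_ge0 // mulr_ge0 // powR_ge0.
apply: (Elayers_le B0 bnd0).
  by move=> L; apply: Ecopies_ge0 => // f; exact: drawAB_ge0.
move=> L sL hL; apply: (readout_le B0 bnd0) => // P sP hP; rewrite gE // lee_fin.
have ok : core_ok M (C * eps ^+ (2 ^ K)) (mpnn_core K rho eps L).
  apply: (hMC eps L _ (ltW ep0) sL hL).
  by rewrite mul1r expr1; apply: core_ok_init; rewrite ltW.
set v := map _ _; have sv : size v = wout by rewrite size_map.
have -> : wout%:R * G `^ p * (eps `^ (p * 2 ^+ K.+1) * D^-1 `^ p) =
    wout%:R * (G * eps ^+ (2 ^ K.+1)) `^ p * D^-1 `^ p.
  rewrite [(G * _) `^ p]powRM ?exprn_ge0 ?(ltW ep0) // -(powR_mulrn _ (ltW ep0)) -powRrM natrX.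
  by rewrite [2 ^+ _ * p]mulrC !mulrA.
rewrite -sv; apply: pnorm_div_powR_le => //; first by rewrite mulr_ge0 // exprn_ge0 // ltW.
move=> k; rewrite size_map => kP; rewrite (nth_map ([::], 0)) //.
have abP := mem_nth ([::], 0) kP.
have [u [t [_ ht [h1 h2 h3] ->]]] := readout_gapE rho ok (Forall_seq_in hP abP).
rewrite normrMn -[X in X <= _]mulr_natl.
have -> : G * eps ^+ (2 ^ K.+1) = 4 * (S * (d * (C * eps ^+ (2 ^ K))) ^+ 2).
  by rewrite /G expnS mulnC exprM; ring.
rewrite ler_wpM2l //; apply: le_trans (hS u t h1 h2 h3) _.
rewrite ler_wpM2l // -(real_normK (num_real t)).
by rewrite ler_pXn2r // nnegrE // (le_trans _ ht).
Qed.
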